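(* Let $R:(-1,1)\to(0,\infty)$ be a smooth function that is even on $(-1,1)$ and decreasing in $[0,1)$, and let $f$ be a real $R$-harmonic mapping of the unit disk $\mathbb{D}$ into the interval $(-1,1)$. Then $$|\nabla f(z)|\le 2\,\frac{1-f(z)^2}{1-|z|^2}\quad\text{for all } z\in\mathbb{D},$$ so that $$d_h(f(z),f(w))\le 2\,d_h(z,w)\quad\text{for all } z,w\in\mathbb{D}.$$ Further, if $f(0)=0$, then $$|f(z)|\le\frac{4}{\pi}\tan^{-1}|z|\quad\text{for all } z\in\mathbb{D}.$$
   Context: $\mathbb{D}=\{z\in\mathbb{C}:|z|<1\}$. For a smooth positive function $R$ on $(-1,1)$ (viewed as the conformal metric density $\rho(u,v)=R(u)$ on the strip $(-1,1)\times\mathbb{R}$), a real-valued $\mathcal{C}^2$ function $f:\mathbb{D}\to(-1,1)$ is called (real) $R$-harmonic if $$\Delta f+\frac{R'(f)}{R(f)}|\nabla f|^2=0\quad\text{on }\mathbb{D},$$ where $\Delta$ and $\nabla$ are the Euclidean Laplacian and gradient. ''Decreasing'' is understood in the weak sense. The hyperbolic distance on $\mathbb{D}$ is $d_h(z,w)=\tanh^{-1}\frac{|z-w|}{|1-z\bar w|}$, applied also to real points of $(-1,1)\subset\mathbb{D}$. *)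

(* Defs.v *)
(* Built on the Stdlib reals and Coquelicot. *)
From Stdlib Require Import Reals Lra.
From Coquelicot Require Import Coquelicot.

Open Scope R_scope.

Definition unit_disk (z : C) : Prop := Cmod z < 1.

(* Functions on the disk are total functions C -> R; the disk being open, the
   notions below evaluated at its points only see the values taken on it. *)

Definition ex_dx (f : C -> R) (z : C) : Prop :=
  ex_derive (fun x : R => f (x, Im z)) (Re z).

Definition ex_dy (f : C -> R) (z : C) : Prop :=
  ex_derive (fun y : R => f (Re z, y)) (Im z).

Definition dx (f : C -> R) (z : C) : R :=
  Derive (fun x : R => f (x, Im z)) (Re z).

Definition dy (f : C -> R) (z : C) : R :=
  Derive (fun y : R => f (Re z, y)) (Im z).

Fixpoint class_C (k : nat) (U : C -> Prop) (f : C -> R) : Prop :=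
  (forall z : C, U z -> continuous f z) /\
  match k with
  | O => True
  | S k' =>
      (forall z : C, U z -> ex_dx f z /\ ex_dy f z) /\
      class_C k' U (dx f) /\ class_C k' U (dy f)
  end.

Definition laplacian (f : C -> R) (z : C) : R := dx (dx f) z + dy (dy f) z.

Definition grad_norm (f : C -> R) (z : C) : R :=
  sqrt ((dx f z) ^ 2 + (dy f z) ^ 2).

Definition smooth_on_interval (rho : R -> R) : Prop :=
  forall (n : nat) (u : R), -1 < u < 1 -> ex_derive_n rho n u.

(* [rho u] is the metric density at (u, v) in the strip (-1,1) x R. *)
Definition R_harmonic (rho : R -> R) (f : C -> R) : Prop :=
  (forall z : C, unit_disk z -> -1 < f z < 1) /\
  class_C 2 unit_disk f /\
  (forall z : C, unit_disk z ->
     laplacian f z + Derive rho (f z) / rho (f z) * (grad_norm f z) ^ 2 = 0).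

Definition artanh (x : R) : R := / 2 * ln ((1 + x) / (1 - x)).

Lemma tanh_artanh (x : R) : -1 < x < 1 -> tanh (artanh x) = x.
Proof.
intros Hx.
assert (Hq : 0 < (1 + x) / (1 - x)) by (apply Rdiv_lt_0_compat; lra).
assert (He : exp (artanh x) * exp (artanh x) = (1 + x) / (1 - x)).
{ rewrite <- exp_plus; unfold artanh.
  replace (_ + _) with (ln ((1 + x) / (1 - x))) by field.
  now apply exp_ln. }
assert (H0 := exp_pos (artanh x)).
unfold tanh, sinh, cosh; rewrite exp_Ropp.
set (e := exp (artanh x)) in *.
assert (Hee : 0 < e * e) by now apply Rmult_lt_0_compat.
replace ((e - / e) / 2 / ((e + / e) / 2)) with ((e * e - 1) / (e * e + 1)).
- rewrite He; field; lra.
- field; split; lra.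
Qed.

Definition d_h (z w : C) : R :=
  artanh (Cmod (z - w)%C / Cmod (1 - z * Cconj w)%C).

(* Main.v *)
Require Import Defs.
From Stdlib Require Import Reals Lra ClassicalEpsilon.
From Coquelicot Require Import Coquelicot.

Open Scope R_scope.

(** Let [P] be the primitive of the density [rho] that vanishes at 0 and [b] its
    supremum on [0, 1), which is finite since [rho] decreases. The equation for
    [f] says that [P f] is harmonic, so [b - P f] and [b + P f] are positive
    harmonic functions on the disk. For a positive harmonic function [v],
    Harnack's inequality says that [log v] is 2-Lipschitz for the hyperbolic
    distance, and its infinitesimal form is
    [|grad v| <= 2 v / (1 - |z|^2)] ([harnack], [harnack_derivative]).

    As [P] is odd and concave on [0, 1), the gap [b - P u] is at most
    [rho u (1 - u)]. This turns the gradient bound for [b - P |f|] into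
    [|grad f| <= 2 (1 - |f|) / (1 - |z|^2)], which is stronger than the claim. The
    distance estimate compares the two given points directly: Harnack's
    inequalities between them, together with slopes of chords of [P], bound the
    cross ratio that [d_h (f z) (f w)] is the logarithm of
    ([potential_cross_ratio]). If [f 0 = 0], then [P f / b] is a harmonic function
    into (-1, 1) vanishing at 0, so the harmonic Schwarz lemma
    ([harmonic_schwarz]) bounds it, and [|f| <= |P f| / b] because the concave
    [P / b] lies above its chord.

    Both facts about harmonic functions are the Schwarz-Pick inequality for maps
    [G] of the disk into the right half-plane ([schwarz_pick_half_plane]), where
    [G] is [v] completed by a harmonic conjugate ([harmonic_conjugate]), or an
    exponential of such a map. It rests on the maximum principle, and this on the
    second derivative test alone: [P f] is of class C^2, so [G] has two complex
    derivatives, and the Laplacian of the squared modulus of a function built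
    from [G] is then non-negative. *)

(** * Complex derivatives *)

Local Notation CV := (AbsRing_NormedModule C_AbsRing).

(** The target is C as a module over itself, normed by [Cmod], rather than the
    product of two real lines: only with that choice do the product and chain
    rules over an arbitrary normed ring apply. *)
Definition is_cderive (f : C -> C) (z l : C) : Prop :=
  is_derive (K := C_AbsRing) (V := CV) f z l.

Lemma is_cderive_iff f z l :
  is_cderive f z l <->
  (forall eps : R, 0 < eps -> exists d : R, 0 < d /\ forall w : C,
     Cmod (w - z)%C < d ->
     Cmod (f w - f z - (w - z) * l)%C <= eps * Cmod (w - z)%C).
Proof.
split.
- intros [_ H] eps Heps.
  destruct (H z (fun P HP => HP) (mkposreal eps Heps)) as [d Hd].
  exists d; split; [apply cond_pos|].
  intros w Hw; exact (Hd w Hw).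
- intros H; split; [apply is_linear_scal_l|].
  intros x Hx.
  apply (is_filter_lim_locally_unique (V := CV)) in Hx. subst x.
  intros eps. destruct (H eps (cond_pos eps)) as (d & Hd & Hw).
  exists (mkposreal d Hd). intros w Hb. exact (Hw w Hb).
Qed.

Lemma is_cderive_mult f g z df dg :
  is_cderive f z df -> is_cderive g z dg ->
  is_cderive (fun w => (f w * g w)%C) z (df * g z + f z * dg)%C.
Proof.
intros Hf Hg. apply (is_derive_mult (K := C_AbsRing) f g z df dg Hf Hg).
intros; apply Cmult_comm.
Qed.

Lemma is_cderive_plus f g z df dg :
  is_cderive f z df -> is_cderive g z dg ->
  is_cderive (fun w => (f w + g w)%C) z (df + dg)%C.
Proof. apply (is_derive_plus (K := C_AbsRing) (V := CV)). Qed.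

Lemma is_cderive_const c z : is_cderive (fun _ => c) z 0%C.
Proof. apply (is_derive_const (K := C_AbsRing) (V := CV)). Qed.

Lemma is_cderive_id z : is_cderive (fun w => w) z 1%C.
Proof. apply (is_derive_id (K := C_AbsRing)). Qed.

Lemma is_cderive_comp f g z df dg :
  is_cderive f (g z) df -> is_cderive g z dg ->
  is_cderive (fun w => f (g w)) z (df * dg)%C.
Proof.
intros Hf Hg. rewrite Cmult_comm.
exact (is_derive_comp (K := C_AbsRing) (V := CV) f g z df dg Hf Hg).
Qed.

Lemma is_cderive_ext_loc f g z l :
  (exists d, 0 < d /\ forall w, Cmod (w - z)%C < d -> f w = g w) ->
  is_cderive f z l -> is_cderive g z l.
Proof.
intros (d & Hd & H). apply (is_derive_ext_loc (K := C_AbsRing) (V := CV)).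
exists (mkposreal d Hd). intros w Hw; exact (H w Hw).
Qed.

Lemma Cmod_le_sum x y : Cmod (x, y) <= Rabs x + Rabs y.
Proof.
replace (x, y) with (RtoC x + Ci * RtoC y)%C.
- eapply Rle_trans; [apply Cmod_triangle|].
  rewrite Cmod_mult, !Cmod_R.
  replace (Cmod Ci) with 1. lra.
  unfold Cmod, Ci; simpl. replace (0 * (0 * 1) + 1 * (1 * 1)) with 1 by ring. now rewrite sqrt_1.
- unfold RtoC, Ci, Cmult, Cplus; simpl. f_equal; ring.
Qed.

Lemma Cmod_ge_Im z : Rabs (Im z) <= Cmod z.
Proof. eapply Rle_trans; [|apply Rmax_Cmod]. apply Rmax_r. Qed.

Lemma locally_Cmod (z : C) (P : C -> Prop) :
  locally z P <-> exists d, 0 < d /\ forall w, Cmod (w - z)%C < d -> P w.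
Proof.
rewrite locally_C. split.
- intros [d H]. exists d; split; [apply cond_pos|]. intros w Hw; exact (H w Hw).
- intros (d & Hd & H). exists (mkposreal d Hd). intros w Hw; exact (H w Hw).
Qed.

Lemma continuous_Cmod_iff (f : C -> R) (z : C) :
  continuous f z <->
  forall eps, 0 < eps -> exists d, 0 < d /\
    forall w, Cmod (w - z)%C < d -> Rabs (f w - f z) < eps.
Proof.
split.
- intros H eps Heps.
  apply locally_Cmod. apply (H (fun y => Rabs (y - f z) < eps)).
  exists (mkposreal eps Heps). intros y Hy; exact Hy.
- intros H P [eps HP].
  apply locally_Cmod. destruct (H eps (cond_pos eps)) as (d & Hd & Hw).
  exists d; split; [exact Hd|]. intros w Hb. apply HP. exact (Hw w Hb).
Qed.

(** A partial derivative that is continuous at the point makes the function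
    differentiable there, even if the other one is known at that point only. *)
Lemma filterdiff_partials (p : C -> R) (z : C) (px : C -> R) (py : R) :
  locally z (fun w => is_derive (fun x => p (x, Im w)) (Re w) (px w)) ->
  is_derive (fun y => p (Re z, y)) (Im z) py ->
  continuous px z ->
  forall eps, 0 < eps -> exists d, 0 < d /\ forall w, Cmod (w - z)%C < d ->
    Rabs (p w - p z - (Re (w - z)%C * px z + Im (w - z)%C * py)) <= eps * Cmod (w - z)%C.
Proof.
intros H1 H2 H3 eps Heps.
destruct z as [x y].
assert (H := is_derive_filterdiff (fun a b => p (a, b)) x y (fun a b => px (a, b)) py).
simpl in *.
destruct H as [_ H].
- revert H1. apply filter_imp. intros [a b] Hab; exact Hab.
- exact H2.
- eapply continuous_ext; [|exact H3]. intros [a b]; reflexivity.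
- specialize (H (x, y) (fun P HP => HP) (mkposreal eps Heps)).
  apply locally_Cmod in H. destruct H as (d & Hd & H).
  exists d; split; [exact Hd|]. intros [a b] Hw. specialize (H (a, b) Hw).
  replace (Cmod ((a, b) - (x, y))%C)
    with (@norm _ (prod_NormedModule R_AbsRing R_NormedModule R_NormedModule)
            (minus (a, b) (x, y))); [exact H|].
  unfold norm; simpl. unfold prod_norm, Cmod. f_equal.
  rewrite <- (pow2_abs (fst _)), <- (pow2_abs (snd _)). reflexivity.
Qed.

(** The Cauchy-Riemann equations: the real differential of (p, q) is then
    multiplication by the complex number (px, qx). *)
Lemma is_cderive_CR (p q px qx : C -> R) (z : C) :
  locally z (fun w => is_derive (fun x => p (x, Im w)) (Re w) (px w)) ->
  locally z (fun w => is_derive (fun x => q (x, Im w)) (Re w) (qx w)) ->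
  is_derive (fun y => p (Re z, y)) (Im z) (- qx z) ->
  is_derive (fun y => q (Re z, y)) (Im z) (px z) ->
  continuous px z -> continuous qx z ->
  is_cderive (fun w => (p w, q w)) z (px z, qx z).
Proof.
intros H1 H2 H3 H4 H5 H6. apply is_cderive_iff. intros eps Heps.
destruct (filterdiff_partials p z px _ H1 H3 H5 (eps / 2)) as (d1 & Hd1 & A1); [lra|].
destruct (filterdiff_partials q z qx _ H2 H4 H6 (eps / 2)) as (d2 & Hd2 & A2); [lra|].
exists (Rmin d1 d2); split; [now apply Rmin_pos|]. intros w Hw.
assert (B1 := A1 w (Rlt_le_trans _ _ _ Hw (Rmin_l _ _))).
assert (B2 := A2 w (Rlt_le_trans _ _ _ Hw (Rmin_r _ _))).
set (n := Cmod (w - z)%C) in *.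
match goal with |- Cmod ?a <= _ => replace a with
  (p w - p z - (Re (w - z)%C * px z + Im (w - z)%C * - qx z),
   q w - q z - (Re (w - z)%C * qx z + Im (w - z)%C * px z)) end.
- eapply Rle_trans; [apply Cmod_le_sum|]. lra.
- destruct w, z; unfold Cminus, Cplus, Copp, Cmult; simpl. f_equal; ring.
Qed.

Lemma is_derive_R_intro (f : R -> R) t l :
  (forall eps, 0 < eps -> exists d, 0 < d /\ forall s, Rabs (s - t) < d ->
     Rabs (f s - f t - (s - t) * l) <= eps * Rabs (s - t)) ->
  is_derive f t l.
Proof.
intros H; split; [apply is_linear_scal_l|].
intros x Hx.
apply (is_filter_lim_locally_unique (V := AbsRing_NormedModule R_AbsRing)) in Hx. subst x.
intros eps. destruct (H eps (cond_pos eps)) as (d & Hd & Hw).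
exists (mkposreal d Hd). intros w Hb. exact (Hw w Hb).
Qed.

Lemma is_cderive_line f z e (t : R) l :
  is_cderive f (z + t * e)%C l ->
  is_derive (fun s : R => Re (f (z + s * e)%C)) t (Re (l * e)%C) /\
  is_derive (fun s : R => Im (f (z + s * e)%C)) t (Im (l * e)%C).
Proof.
intros H. assert (H0 := proj1 (is_cderive_iff _ _ _) H); clear H; rename H0 into H.
assert (K : forall eps, 0 < eps -> exists d, 0 < d /\ forall s : R, Rabs (s - t) < d ->
   Cmod (f (z + s * e) - f (z + t * e) - (RtoC (s - t)) * (l * e))%C <= eps * Rabs (s - t)).
{ intros eps Heps.
  assert (Hc := Cmod_ge_0 e).
  destruct (H (eps / (Cmod e + 1))) as (d & Hd & A).
  { apply Rdiv_lt_0_compat; lra. }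
  exists (d / (Cmod e + 1)); split; [apply Rdiv_lt_0_compat; lra|].
  intros s Hs.
  assert (E : (z + s * e - (z + t * e) = RtoC (s - t) * e)%C) by (rewrite RtoC_minus; ring).
  assert (B := A (z + s * e)%C). rewrite E, Cmod_mult, Cmod_R in B.
  assert (Hs0 := Rabs_pos (s - t)).
  assert (H1 : Rabs (s - t) * (Cmod e + 1) < d).
  { apply (Rmult_lt_compat_r (Cmod e + 1)) in Hs; [|lra].
    replace (d / (Cmod e + 1) * (Cmod e + 1)) with d in Hs by (field; lra). exact Hs. }
  replace (f (z + s * e) - f (z + t * e) - RtoC (s - t) * (l * e))%C
    with (f (z + s * e) - f (z + t * e) - RtoC (s - t) * e * l)%C by ring.
  eapply Rle_trans; [apply B; nra|].
  replace (eps * Rabs (s - t)) with (eps / (Cmod e + 1) * (Rabs (s - t) * (Cmod e + 1)))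
    by (field; lra).
  apply Rmult_le_compat_l; [left; apply Rdiv_lt_0_compat; lra|nra]. }
assert (KR : forall a b (s : R) c, Re (a - b - RtoC s * c)%C = Re a - Re b - s * Re c)
  by (intros [] [] ? []; simpl; ring).
assert (KI : forall a b (s : R) c, Im (a - b - RtoC s * c)%C = Im a - Im b - s * Im c)
  by (intros [] [] ? []; simpl; ring).
split; apply is_derive_R_intro; intros eps Heps;
  destruct (K eps Heps) as (d & Hd & A); exists d; (split; [exact Hd|]);
  intros s Hs; (eapply Rle_trans; [|exact (A s Hs)]).
- rewrite <- KR. apply re_le_Cmod.
- rewrite <- KI. apply Cmod_ge_Im.
Qed.

(** The Lipschitz bound at the point, with constant [Cmod l + 1], is what bounds
    quotients by [w - z] near a zero of [f]. *)
Lemma is_cderive_continuous f z l :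
  is_cderive f z l ->
  forall eps, 0 < eps -> exists d, 0 < d /\ forall w, Cmod (w - z)%C < d ->
    Cmod (f w - f z)%C <= (Cmod l + 1) * Cmod (w - z)%C /\ Cmod (f w - f z)%C < eps.
Proof.
intros H eps Heps. assert (H0 := proj1 (is_cderive_iff _ _ _) H); clear H; rename H0 into H.
destruct (H 1 Rlt_0_1) as (d & Hd & A).
assert (Hl := Cmod_ge_0 l).
exists (Rmin d (eps / (Cmod l + 1))).
split; [apply Rmin_pos; [exact Hd|apply Rdiv_lt_0_compat; lra]|].
intros w Hw.
assert (B := A w (Rlt_le_trans _ _ _ Hw (Rmin_l _ _))).
assert (B2 := Rlt_le_trans _ _ _ Hw (Rmin_r _ _)).
assert (B3 : Cmod (f w - f z)%C <= (Cmod l + 1) * Cmod (w - z)%C).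
{ replace (f w - f z)%C with ((f w - f z - (w - z) * l) + (w - z) * l)%C by ring.
  eapply Rle_trans; [apply Cmod_triangle|]. rewrite Cmod_mult. nra. }
split; [exact B3|].
apply (Rmult_lt_compat_l (Cmod l + 1)) in B2; [|lra].
replace ((Cmod l + 1) * (eps / (Cmod l + 1))) with eps in B2 by (field; lra). lra.
Qed.

Lemma Cmod_dist (w z : C) : Rabs (Cmod w - Cmod z) <= Cmod (w - z)%C.
Proof.
assert (T1 := Cmod_triangle (w - z) z). assert (T2 := Cmod_triangle (- (w - z)) w).
rewrite Cmod_opp in T2.
replace (w - z + z)%C with w in T1 by ring. replace (- (w - z) + w)%C with z in T2 by ring.
apply Rabs_le_between. lra.
Qed.

Lemma Cmod_sqr z : Cmod z ^ 2 = Re z ^ 2 + Im z ^ 2.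
Proof.
unfold Cmod. rewrite pow2_sqrt; [reflexivity|].
apply Rplus_le_le_0_compat; apply pow2_ge_0.
Qed.

(** * Functions with two complex derivatives *)

(** Two complex derivatives are what the second derivative test consumes, and
    exactly what completing a harmonic function of class C^2 provides. *)
Definition hol2 (U : C -> Prop) (f : C -> C) : Prop :=
  exists f' f'' : C -> C, forall z, U z ->
    is_cderive f z (f' z) /\ is_cderive f' z (f'' z).

Lemma hol2_const U c : hol2 U (fun _ => c).
Proof.
exists (fun _ => 0%C), (fun _ => 0%C). intros z _; split; apply is_cderive_const.
Qed.

Lemma hol2_id U : hol2 U (fun z => z).
Proof.
exists (fun _ => 1%C), (fun _ => 0%C). intros z _; split; [apply is_cderive_id|apply is_cderive_const].
Qed.

Lemma hol2_plus U f g : hol2 U f -> hol2 U g -> hol2 U (fun z => (f z + g z)%C).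
Proof.
intros (f1 & f2 & F) (g1 & g2 & G).
exists (fun z => (f1 z + g1 z)%C), (fun z => (f2 z + g2 z)%C).
intros z Hz; destruct (F z Hz), (G z Hz); split; now apply is_cderive_plus.
Qed.

Lemma hol2_mult U f g : hol2 U f -> hol2 U g -> hol2 U (fun z => (f z * g z)%C).
Proof.
intros (f1 & f2 & F) (g1 & g2 & G).
exists (fun z => (f1 z * g z + f z * g1 z)%C),
       (fun z => ((f2 z * g z + f1 z * g1 z) + (f1 z * g1 z + f z * g2 z))%C).
intros z Hz; destruct (F z Hz), (G z Hz); split.
- now apply is_cderive_mult.
- apply is_cderive_plus; now apply is_cderive_mult.
Qed.

Lemma hol2_comp U V h f : (forall z, U z -> V (f z)) ->
  hol2 V h -> hol2 U f -> hol2 U (fun z => h (f z)).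
Proof.
intros HUV (h1 & h2 & H) (f1 & f2 & F).
exists (fun z => (h1 (f z) * f1 z)%C),
       (fun z => (h2 (f z) * f1 z * f1 z + h1 (f z) * f2 z)%C).
intros z Hz; destruct (F z Hz), (H (f z) (HUV z Hz)); split.
- now apply is_cderive_comp.
- apply (is_cderive_mult (fun z => h1 (f z)) f1); [|assumption].
  now apply is_cderive_comp.
Qed.

(** The error term of the difference quotient is exactly
    [(w - z)^2 / (w z^2)]. *)
Lemma is_cderive_inv (z : C) : z <> 0%C -> is_cderive Cinv z (- (/ (z * z)))%C.
Proof.
intros Hz. apply is_cderive_iff. intros eps Heps.
assert (Hm := proj1 (Cmod_gt_0 z) Hz). set (m := Cmod z) in *.
assert (Hm3 : 0 < m * m * m) by (repeat apply Rmult_lt_0_compat; lra).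
exists (Rmin (m / 2) (eps * (m * m * m) / 2)). split.
{ apply Rmin_pos; [lra|]. assert (0 < eps * (m * m * m)) by now apply Rmult_lt_0_compat. lra. }
intros w Hw.
assert (Hw1 := Rlt_le_trans _ _ _ Hw (Rmin_l _ _)).
assert (Hw2 := Rlt_le_trans _ _ _ Hw (Rmin_r _ _)).
assert (Hwm : m / 2 < Cmod w).
{ assert (T := Cmod_triangle w (- (w - z))%C). rewrite Cmod_opp in T.
  replace (w + - (w - z))%C with z in T by ring. fold m in T. lra. }
assert (Hw0 : w <> 0%C) by (intros ->; rewrite Cmod_0 in Hwm; lra).
replace (/ w - / z - (w - z) * - / (z * z))%C with ((w - z) * (w - z) / (w * z * z))%C
  by (field; split; assumption).
rewrite Cmod_div by (repeat apply Cmult_neq_0; assumption).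
rewrite !Cmod_mult. fold m. set (k := Cmod (w - z)%C) in *.
assert (Hk : 0 <= k) by apply Cmod_ge_0.
assert (Hd : 0 < Cmod w * m * m) by (repeat apply Rmult_lt_0_compat; lra).
apply (Rmult_le_reg_r (Cmod w * m * m)); [exact Hd|].
replace (k * k / (Cmod w * m * m) * (Cmod w * m * m)) with (k * k) by (field; lra).
rewrite (Rmult_comm eps k), Rmult_assoc. apply Rmult_le_compat_l; [exact Hk|].
apply Rle_trans with (eps * (m * m * m) / 2); [lra|].
replace (eps * (m * m * m) / 2) with (eps * ((m / 2) * m * m)) by field.
apply Rmult_le_compat_l; [lra|]. repeat apply Rmult_le_compat_r; lra.
Qed.

Lemma hol2_inv U (f : C -> C) : (forall z, U z -> f z <> 0%C) -> hol2 U f -> hol2 U (fun z => / f z)%C.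
Proof.
intros Hf HF; apply (hol2_comp U (fun z : C => z <> 0%C) Cinv f Hf); [|exact HF].
exists (fun z => (- (/ (z * z)))%C), (fun z => (RtoC 2 * / (z * z * z))%C).
intros z Hz; split; [now apply is_cderive_inv|].
assert (Hzz : (z * z <> 0)%C) by now apply Cmult_neq_0.
replace (RtoC 2 * / (z * z * z))%C
  with (0 * (/ (z * z)) + (RtoC (-1)) * (- (/ ((z * z) * (z * z))) * (1 * z + z * 1)))%C
  by (replace (RtoC 2) with (1 + 1)%C by (rewrite <- RtoC_plus; f_equal; ring);
      replace (RtoC (-1)) with (- (1))%C by (rewrite <- RtoC_opp; f_equal; ring);
      field; exact Hz).
apply (is_cderive_ext_loc (fun w => (RtoC (-1) * (/ (w * w)))%C)).
{ exists 1; split; [lra|]. intros w _.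
  replace (RtoC (-1)) with (- (1))%C by (rewrite <- RtoC_opp; f_equal; ring). ring. }
apply (is_cderive_mult (fun _ => RtoC (-1)) (fun w => / (w * w))%C).
- apply is_cderive_const.
- apply (is_cderive_comp Cinv (fun w => (w * w)%C)).
  + now apply is_cderive_inv.
  + apply (is_cderive_mult (fun w => w) (fun w => w)); apply is_cderive_id.
Qed.

Lemma hol2_pow U f n : hol2 U f -> hol2 U (fun z => Cpow (f z) n).
Proof.
intros Hf. induction n as [|n IH]; simpl; [apply hol2_const|].
now apply hol2_mult.
Qed.

Definition cexp (z : C) : C := (exp (Re z) * cos (Im z), exp (Re z) * sin (Im z)).

Lemma is_cderive_cexp z : is_cderive cexp z (cexp z).
Proof.
assert (CR : continuous (fun w : C => Re w) z) by (destruct z; apply continuous_fst).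
assert (CI : continuous (fun w : C => Im w) z) by (destruct z; apply continuous_snd).
assert (CE : continuous (fun w : C => exp (Re w)) z)
  by (apply (continuous_comp (fun w : C => Re w) exp); [exact CR|apply continuous_exp]).
apply (is_cderive_CR (fun w => exp (Re w) * cos (Im w)) (fun w => exp (Re w) * sin (Im w))
         (fun w => exp (Re w) * cos (Im w)) (fun w => exp (Re w) * sin (Im w)) z).
- apply filter_forall. intros w; simpl. auto_derive; [exact I|ring].
- apply filter_forall. intros w; simpl. auto_derive; [exact I|ring].
- simpl. auto_derive; [exact I|ring].
- simpl. auto_derive; [exact I|ring].
- apply (continuous_mult (K := R_AbsRing)); [exact CE|].
  apply (continuous_comp (fun w : C => Im w) cos); [exact CI|apply continuous_cos].
- apply (continuous_mult (K := R_AbsRing)); [exact CE|].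
  apply (continuous_comp (fun w : C => Im w) sin); [exact CI|apply continuous_sin].
Qed.

Lemma hol2_cexp U : hol2 U cexp.
Proof. exists cexp, cexp. intros z _; split; apply is_cderive_cexp. Qed.

(** * Compactness of the closed disk *)

(** Compactness of the closed disk in the form of a Lebesgue number: local
    radii, one per centre, can be traded for a common lower bound. It is reduced
    to the square around the disk by giving each point outside the disk a radius
    that keeps away from the disk. *)
Lemma disk_uniform_gauge (r : R) (P : C -> R -> Prop) :
  0 < r ->
  (forall z, Cmod z <= r -> exists e, 0 < e /\ P z e) ->
  exists d, 0 < d /\ forall w, Cmod w <= r ->
    exists z e, Cmod z <= r /\ P z e /\ d <= e /\ Cmod (w - z)%C < e.
Proof.
intros Hr HP.
assert (G : forall z : C, exists e : posreal,
   (Cmod z <= r -> P z (2 * e)) /\ (r < Cmod z -> 2 * e <= Cmod z - r)).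
{ intros z. destruct (Rle_lt_dec (Cmod z) r) as [Hz|Hz].
  - destruct (HP z Hz) as (e & He & Q).
    assert (He2 : 0 < e / 2) by lra.
    exists (mkposreal _ He2); simpl. split; [|lra].
    intros _. replace (2 * (e / 2)) with e by field. exact Q.
  - assert (He2 : 0 < (Cmod z - r) / 2) by lra.
    exists (mkposreal _ He2); simpl. lra. }
set (g := fun z : C => proj1_sig (constructive_indefinite_description _ (G z))).
assert (Hg : forall z, (Cmod z <= r -> P z (2 * g z)) /\ (r < Cmod z -> 2 * g z <= Cmod z - r)).
{ intros z. exact (proj2_sig (constructive_indefinite_description _ (G z))). }
destruct (compactness_value_2d (- r) r (- r) r (fun u v => g (u, v))) as [d Hd].
exists d; split; [apply cond_pos|]. intros w Hw.
apply NNPP. intros HN.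
assert (H1 := re_le_Cmod w). assert (H2 := Cmod_ge_Im w).
apply (Hd (Re w) (Im w)).
{ apply Rabs_le_between; lra. }
{ apply Rabs_le_between; lra. }
intros (u & v & _ & _ & Hu & Hv & Hdd). apply HN.
destruct (Hg (u, v)) as [HgP HgN].
assert (Hc : Cmod (w - (u, v))%C < 2 * g (u, v)).
{ destruct w as [a b]. eapply Rle_lt_trans; [apply Cmod_le_sum|]. simpl in *.
  unfold Rminus in *. lra. }
assert (Hg0 := cond_pos (g (u, v))).
destruct (Rle_lt_dec (Cmod (u, v)) r) as [Hz|Hz].
- exists (u, v), (2 * g (u, v)). repeat split; auto. lra.
- exfalso. specialize (HgN Hz).
  assert (T := Cmod_triangle w ((u, v) - w)%C).
  replace (w + ((u, v) - w))%C with ((u, v) : C) in T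
    by (destruct w; unfold Cminus, Cplus, Copp; simpl; f_equal; ring).
  replace ((u, v) - w)%C with (- (w - (u, v)))%C in T
    by (destruct w; unfold Cminus, Cplus, Copp; simpl; f_equal; ring).
  rewrite Cmod_opp in T. lra.
Qed.

(** Upper semicontinuity is enough for a maximum to be attained. The Lebesgue
    number is used twice: for a common upper bound, then for a common gap below
    the supremum if it were not attained. *)
Lemma disk_max (S : C -> R) (r : R) :
  0 < r ->
  (forall z, Cmod z <= r -> forall eps, 0 < eps -> exists d, 0 < d /\
     forall w, Cmod (w - z)%C < d -> S w < S z + eps) ->
  exists z, Cmod z <= r /\ forall w, Cmod w <= r -> S w <= S z.
Proof.
intros Hr HS.
assert (Hb : exists m, forall w, Cmod w <= r -> S w <= m).
{ destruct (disk_uniform_gauge r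
     (fun z e => forall w, Cmod (w - z)%C < e -> S w <= / e) Hr) as (d & Hd & A).
  (* a radius e for which S <= 1 / e nearby, so that e >= d bounds S by 1 / d *)
  - intros z Hz. destruct (HS z Hz 1 Rlt_0_1) as (d & Hd & B).
    set (k := / (Rabs (S z) + 1)).
    assert (Hk0 := Rabs_pos (S z)).
    assert (Hk : 0 < k) by (apply Rinv_0_lt_compat; lra).
    exists (Rmin d k); split; [now apply Rmin_pos|].
    intros w Hw. specialize (B w (Rlt_le_trans _ _ _ Hw (Rmin_l _ _))).
    apply Rle_trans with (/ k).
    + unfold k; rewrite Rinv_inv. assert (T := Rle_abs (S z)). lra.
    + apply Rinv_le_contravar; [now apply Rmin_pos|apply Rmin_r].
  - exists (/ d). intros w Hw. destruct (A w Hw) as (z & e & _ & B & Hde & Hwe).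
    apply Rle_trans with (/ e); [now apply B|]. now apply Rinv_le_contravar. }
destruct (completeness (fun y => exists w, Cmod w <= r /\ y = S w)) as [M [HM1 HM2]].
{ destruct Hb as [m Hm]. exists m. intros y (w & Hw & ->). now apply Hm. }
{ exists (S 0%C), 0%C. rewrite Cmod_0. split; [lra|reflexivity]. }
apply NNPP. intros HN.
assert (Hlt : forall z, Cmod z <= r -> S z < M).
{ intros z Hz. assert (H1 : S z <= M) by (apply HM1; now exists z).
  destruct H1 as [H1|H1]; [exact H1|]. exfalso. apply HN. exists z. split; [exact Hz|].
  intros w Hw. rewrite H1. apply HM1. now exists w. }
destruct (disk_uniform_gauge r
     (fun z e => forall w, Cmod (w - z)%C < e -> S w <= M - e) Hr) as (d & Hd & A).
(* a radius e for which S <= M - e nearby, so that e >= d leaves the gap d *)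
- intros z Hz. specialize (Hlt z Hz).
  destruct (HS z Hz ((M - S z) / 2)) as (d & Hd & B); [lra|].
  exists (Rmin d ((M - S z) / 2)); split; [apply Rmin_pos; lra|].
  intros w Hw. specialize (B w (Rlt_le_trans _ _ _ Hw (Rmin_l _ _))).
  assert (T := Rmin_r d ((M - S z) / 2)). lra.
- assert (M <= M - d); [|lra]. apply HM2. intros y (w & Hw & ->).
  destruct (A w Hw) as (z & e & _ & B & Hde & Hwe). specialize (B w Hwe). lra.
Qed.

(** * The maximum principle *)

Lemma convex_critical_increase (p p' : R -> R) (c d : R) :
  0 < d -> 0 < c ->
  (forall t, Rabs t < d -> is_derive p t (p' t)) ->
  is_derive p' 0 c -> 0 <= p' 0 ->
  exists t, Rabs t < d /\ p 0 < p t.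
Proof.
intros Hd Hc H1 H2 H0.
assert (K : exists e, 0 < e /\ forall s, Rabs s < e ->
   Rabs (p' s - p' 0 - s * c) <= c / 2 * Rabs s).
{ destruct H2 as [_ H2].
  assert (Hc2 : 0 < c / 2) by lra.
  destruct (H2 0 (fun P HP => HP) (mkposreal _ Hc2)) as [e He].
  exists e; split; [apply cond_pos|]. intros s Hs.
  assert (E : ball 0 e s).
  { unfold ball; simpl; unfold AbsRing_ball, abs, minus, plus, opp; simpl.
    now replace (s + - 0) with s by ring. }
  specialize (He s E). unfold norm, minus, plus, opp, scal, mult in He; simpl in He.
  unfold abs, mult in He; simpl in He.
  replace (s + - 0) with s in He by ring. exact He. }
destruct K as (e & He & K).
set (s := Rmin d e / 2).
assert (Hm : 0 < Rmin d e) by now apply Rmin_pos.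
assert (Hsd := Rmin_l d e). assert (Hse := Rmin_r d e).
assert (Hs : 0 < s) by (unfold s; lra).
exists s. assert (Hsd' : s < d) by (unfold s; lra). assert (Hse' : s < e) by (unfold s; lra).
rewrite Rabs_pos_eq by lra. split; [exact Hsd'|].
destruct (MVT_cor2 p p' 0 s Hs) as (x & E & Hx).
- intros x Hx. apply is_derive_Reals, H1. rewrite Rabs_pos_eq; lra.
- assert (B := K x). rewrite !(Rabs_pos_eq x) in B by lra.
  assert (B' := B ltac:(lra)). apply Rabs_le_between in B'.
  assert (0 < p' x) by nra. nra.
Qed.

(** Whatever the sign of the first derivative, a positive second derivative
    gives an increase to the right or, after reflection, to the left. *)
Lemma second_derivative_test (p p' : R -> R) (c d : R) :
  0 < d ->
  (forall t, Rabs t < d -> is_derive p t (p' t)) ->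
  is_derive p' 0 c ->
  (forall t, Rabs t < d -> p t <= p 0) ->
  c <= 0.
Proof.
intros Hd H1 H2 H3. apply Rnot_lt_le. intros Hc.
destruct (Rle_lt_dec 0 (p' 0)) as [H0|H0].
- destruct (convex_critical_increase p p' c d Hd Hc H1 H2 H0) as (t & Ht & A).
  specialize (H3 t Ht). lra.
- assert (Hrev : forall (q : R -> R) (t l : R),
     is_derive q (- t) l -> is_derive (fun s => q (- s)) t (- l)).
  { intros q t l Hq. replace (- l) with (scal (-1) l)
      by (unfold scal; simpl; unfold mult; simpl; ring).
    apply (is_derive_comp q Ropp); [exact Hq|]. auto_derive; [exact I|ring]. }
  destruct (convex_critical_increase (fun t => p (- t)) (fun t => - p' (- t)) c d Hd Hc)
    as (t & Ht & A).
  + intros t Ht. assert (A := H1 (- t)). rewrite Rabs_Ropp in A. specialize (A Ht).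
    now apply Hrev.
  + replace c with (- - c) by ring.
    apply (is_derive_opp (fun t => p' (- t))). apply Hrev. now rewrite Ropp_0.
  + rewrite Ropp_0. lra.
  + rewrite Ropp_0 in A. specialize (H3 (- t)). rewrite Rabs_Ropp in H3. specialize (H3 Ht). lra.
Qed.

Lemma is_derive_eq (f : R -> R) t l l' : is_derive f t l -> l = l' -> is_derive f t l'.
Proof. now intros H <-. Qed.

Lemma is_derive_ext_R (f g : R -> R) t l :
  (forall s : R, f s = g s) -> is_derive f t l -> is_derive g t l.
Proof. exact (is_derive_ext (K := R_AbsRing) (V := R_NormedModule) f g t l). Qed.

Lemma is_derive_dot (f1 f2 h1 h2 : R -> R) (t a1 a2 b1 b2 : R) :
  is_derive f1 t a1 -> is_derive f2 t a2 -> is_derive h1 t b1 -> is_derive h2 t b2 ->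
  is_derive (fun s => f1 s * h1 s + f2 s * h2 s) t
    (a1 * h1 t + f1 t * b1 + (a2 * h2 t + f2 t * b2)).
Proof.
intros A1 A2 B1 B2.
apply (is_derive_plus (K := R_AbsRing) (V := R_NormedModule));
  apply (is_derive_mult (K := R_AbsRing)); auto using Rmult_comm.
Qed.

(** Half the second derivative of [|F|^2 + k |.|^2] along the line with
    direction [e] is the left-hand side. The term with [F''] carries the factor
    [e^2], so it changes sign from [e = 1] to [e = i]. *)
Lemma hol2_line_second_derivative (U : C -> Prop) (F F' F'' : C -> C) (z e : C) (rad k : R) :
  (forall w, U w -> is_cderive F w (F' w) /\ is_cderive F' w (F'' w)) ->
  0 < rad -> (forall w, Cmod (w - z)%C < rad -> U w) ->
  (forall w, Cmod (w - z)%C < rad ->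
     Cmod (F w) ^ 2 + k * Cmod w ^ 2 <= Cmod (F z) ^ 2 + k * Cmod z ^ 2) ->
  Cmod e = 1 ->
  Cmod (F' z) ^ 2 + (Re (F z) * Re (F'' z * (e * e))%C + Im (F z) * Im (F'' z * (e * e))%C) + k <= 0.
Proof.
intros HF Hr HU Hmax He.
set (l := fun t : R => (z + t * e)%C).
assert (Hl : forall t, Rabs t < rad -> Cmod (l t - z)%C < rad).
{ intros t Ht. unfold l. replace (z + t * e - z)%C with (RtoC t * e)%C by ring.
  rewrite Cmod_mult, He, Cmod_R. lra. }
assert (Hl0 : l 0 = z) by (unfold l; ring).
set (p := fun t => Cmod (F (l t)) ^ 2 + k * Cmod (l t) ^ 2).
set (p' := fun t => 2 * (Re (F (l t)) * Re (F' (l t) * e)%C + Im (F (l t)) * Im (F' (l t) * e)%C)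
                    + 2 * k * (Re (l t) * Re e + Im (l t) * Im e)).
set (c := 2 * (Re (F' z * e)%C ^ 2 + Re (F z) * Re (F'' z * e * e)%C
             + (Im (F' z * e)%C ^ 2 + Im (F z) * Im (F'' z * e * e)%C))
          + 2 * k * (Re e ^ 2 + Im e ^ 2)).
assert (Hc : c <= 0).
{ assert (Dl : forall t, is_derive (fun t => Re (l t)) t (Re e) /\ is_derive (fun t => Im (l t)) t (Im e)).
  { intros t. assert (D := is_cderive_line (fun w => w) z e t 1%C (is_cderive_id _)).
    replace (1 * e)%C with e in D by ring. exact D. }
  apply (second_derivative_test p p' c rad Hr).
  - intros t Ht.
    destruct (HF (l t) (HU _ (Hl t Ht))) as [D1 _].
    destruct (is_cderive_line F z e t _ D1) as [A1 A2].
    destruct (Dl t) as [B1 B2].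
    apply (is_derive_ext_R (fun s =>
      (Re (F (l s)) * Re (F (l s)) + Im (F (l s)) * Im (F (l s)))
      + k * (Re (l s) * Re (l s) + Im (l s) * Im (l s)))).
    { intros s. unfold p. rewrite !Cmod_sqr. ring. }
    eapply is_derive_eq.
    + apply (is_derive_plus (K := R_AbsRing) (V := R_NormedModule)).
      * exact (is_derive_dot _ _ _ _ t _ _ _ _ A1 A2 A1 A2).
      * apply is_derive_scal.
        exact (is_derive_dot _ _ _ _ t _ _ _ _ B1 B2 B1 B2).
    + unfold p', plus, scal, mult; simpl; unfold mult; simpl. unfold l. ring.
  - assert (Hz : Cmod (l 0 - z)%C < rad) by (apply Hl; rewrite Rabs_R0; exact Hr).
    destruct (HF (l 0) (HU _ Hz)) as [D1 D2].
    destruct (is_cderive_line F z e 0 _ D1) as [A1 A2].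
    destruct (is_cderive_line (fun w => (F' w * e)%C) z e 0 (F'' (l 0) * e + F' (l 0) * 0)%C) as [E1 E2].
    { apply (is_cderive_mult F' (fun _ => e)); [exact D2|apply is_cderive_const]. }
    replace ((F'' (l 0) * e + F' (l 0) * 0) * e)%C with (F'' (l 0) * e * e)%C in E1, E2 by ring.
    destruct (Dl 0) as [B1 B2].
    assert (C1 : forall c, is_derive (fun _ : R => c) 0 0)
      by (intros c'; apply (is_derive_const (K := R_AbsRing) (V := R_NormedModule))).
    eapply is_derive_eq.
    + apply (is_derive_plus (K := R_AbsRing) (V := R_NormedModule)).
      * apply is_derive_scal.
        exact (is_derive_dot _ _ _ _ 0 _ _ _ _ A1 A2 E1 E2).
      * apply is_derive_scal.
        exact (is_derive_dot _ _ _ _ 0 _ _ _ _ B1 B2 (C1 (Re e)) (C1 (Im e))).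
    + rewrite Hl0. assert (Hz0 : (z + 0 * e)%C = z) by exact Hl0. rewrite !Hz0.
      unfold c, plus, scal, mult; simpl; unfold mult; simpl. ring.
  - intros t Ht. unfold p. rewrite Hl0. apply Hmax, Hl, Ht. }
assert (H1 : Re (F' z * e)%C ^ 2 + Im (F' z * e)%C ^ 2 = Cmod (F' z) ^ 2)
  by (rewrite <- Cmod_sqr, Cmod_mult, He; ring).
assert (H2 : Re e ^ 2 + Im e ^ 2 = 1) by (rewrite <- Cmod_sqr, He; ring).
unfold c in Hc. rewrite H2 in Hc. rewrite Cmult_assoc. lra.
Qed.

(** The Laplacian of [|F|^2] is [4 |F'|^2]; the term [k |.|^2] makes it strictly
    positive, which excludes a maximum. *)
Lemma hol2_no_local_max (U : C -> Prop) (F : C -> C) (z : C) (rad k : R) :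
  hol2 U F -> 0 < rad -> (forall w, Cmod (w - z)%C < rad -> U w) -> 0 < k ->
  ~ (forall w, Cmod (w - z)%C < rad ->
       Cmod (F w) ^ 2 + k * Cmod w ^ 2 <= Cmod (F z) ^ 2 + k * Cmod z ^ 2).
Proof.
intros (F' & F'' & HF) Hr HU Hk Hmax.
assert (A := fun e => hol2_line_second_derivative U F F' F'' z e rad k HF Hr HU Hmax).
assert (A1 := A 1%C Cmod_1).
assert (Hi : Cmod Ci = 1).
{ unfold Cmod, Ci; simpl. replace (0 * (0 * 1) + 1 * (1 * 1)) with 1 by ring. apply sqrt_1. }
assert (A2 := A Ci Hi).
rewrite Cmult_1_r, Cmult_1_r in A1.
assert (E : forall a, Re (a * (Ci * Ci))%C = - Re a /\ Im (a * (Ci * Ci))%C = - Im a)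
  by (intros [a b]; simpl; split; ring).
destruct (E (F'' z)) as [E1 E2]. rewrite E1, E2 in A2.
assert (B := pow2_ge_0 (Cmod (F' z))). lra.
Qed.

(** At its zeros [F] need not be differentiable: the value there is already below
    the bound. This is how a removable singularity enters the Schwarz lemma. *)
Lemma disk_max_principle (F : C -> C) (r m : R) :
  0 < r < 1 -> 0 <= m ->
  (forall z, Cmod z <= r -> continuous (fun w => Cmod (F w)) z) ->
  (forall z, Cmod z < r -> F z <> 0%C ->
     exists (U : C -> Prop) rad, 0 < rad /\ (forall w, Cmod (w - z)%C < rad -> U w) /\ hol2 U F) ->
  (forall z, Cmod z = r -> Cmod (F z) <= m) ->
  forall z, Cmod z <= r -> Cmod (F z) <= m.
Proof.
intros [Hr Hr1] Hm Hcont Hhol Hbd z1 Hz1.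
apply Rnot_lt_le. intros Hlt.
(* small enough that the value at z1 still exceeds all boundary values *)
set (k := (Cmod (F z1) ^ 2 - m ^ 2) / 2).
assert (Hk : 0 < k) by (unfold k; nra).
destruct (disk_max (fun w => Cmod (F w) ^ 2 + k * Cmod w ^ 2) r Hr) as (z0 & Hz0 & Hmax).
{ intros z Hz eps Heps.
  assert (Hc : continuous (fun w => Cmod (F w) ^ 2 + k * Cmod w ^ 2) z).
  { apply (continuous_plus (fun w => Cmod (F w) ^ 2) (fun w => k * Cmod w ^ 2)).
    - apply (continuous_comp (fun w => Cmod (F w)) (fun x => x ^ 2)); [now apply Hcont|].
      apply (ex_derive_continuous (fun x => x ^ 2)). auto_derive; exact I.
    - apply (continuous_comp (fun w => Cmod w) (fun x => k * x ^ 2)).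
      + apply continuous_Cmod_iff. intros e He. exists e; split; [exact He|]. intros w Hw.
        eapply Rle_lt_trans; [|exact Hw]. apply Cmod_dist.
      + apply (ex_derive_continuous (fun x => k * x ^ 2)). auto_derive; exact I. }
  destruct (proj1 (continuous_Cmod_iff _ _) Hc eps Heps) as (d & Hd & B).
  exists d; split; [exact Hd|]. intros w Hw. specialize (B w Hw).
  apply Rabs_def2 in B. lra. }
assert (A := Hmax z1 Hz1). simpl in A.
assert (P0 := Cmod_ge_0 z0). assert (P1 := Cmod_ge_0 z1). assert (PF := Cmod_ge_0 (F z0)).
assert (Hz0k : Cmod z0 ^ 2 < 1) by nra.
assert (Hz0i : Cmod z0 < r).
{ destruct Hz0 as [H|H]; [exact H|]. specialize (Hbd z0 H).
  assert (Cmod (F z0) ^ 2 <= m ^ 2) by nra. unfold k in *. nra. }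
assert (HF0 : F z0 <> 0%C).
{ intros H. rewrite H, Cmod_0 in A. unfold k in *. nra. }
destruct (Hhol z0 Hz0i HF0) as (U & rad & Hrad & HU & HF).
assert (Hrad' : 0 < Rmin rad (r - Cmod z0)) by (apply Rmin_pos; lra).
apply (hol2_no_local_max U F z0 _ k HF Hrad').
- intros w Hw. apply HU. eapply Rlt_le_trans; [exact Hw|apply Rmin_l].
- exact Hk.
- intros w Hw. apply Hmax.
  assert (T := Cmod_triangle z0 (w - z0)%C). replace (z0 + (w - z0))%C with w in T by ring.
  assert (T2 := Rlt_le_trans _ _ _ Hw (Rmin_r _ _)). lra.
Qed.

(** * The Schwarz-Pick and Harnack inequalities *)

(** The pseudo-hyperbolic distance: [d_h] is its image under [artanh]. *)
Definition pseudo_dist (z w : C) : R := Cmod (z - w)%C / Cmod (1 - z * Cconj w)%C.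

Lemma disk_automorphism_identity (z w : C) :
  Cmod (1 - z * Cconj w)%C ^ 2 - Cmod (z - w)%C ^ 2 = (1 - Cmod z ^ 2) * (1 - Cmod w ^ 2).
Proof. rewrite !Cmod_sqr. destruct z, w; simpl. ring. Qed.

Lemma disk_denominator_bound (z w : C) :
  unit_disk z -> unit_disk w ->
  1 - Cmod w <= Cmod (1 - z * Cconj w)%C <= 2.
Proof.
unfold unit_disk. intros Hz Hw.
assert (P := Cmod_ge_0 z). assert (Q := Cmod_ge_0 w).
assert (E : Cmod (z * Cconj w)%C = Cmod z * Cmod w) by now rewrite Cmod_mult, Cmod_conj.
assert (T := Cmod_dist 1%C (z * Cconj w)%C).
assert (T1 := Cmod_triangle 1%C (- (z * Cconj w))%C). rewrite Cmod_opp in T1.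
rewrite E, Cmod_1 in *. apply Rabs_le_between in T. unfold Cminus. unfold Cminus in T.
split; nra.
Qed.

Lemma pseudo_dist_bounds (z w : C) :
  unit_disk z -> unit_disk w -> 0 <= pseudo_dist z w < 1.
Proof.
intros Hz Hw. destruct (disk_denominator_bound z w Hz Hw) as [HB _].
assert (I := disk_automorphism_identity z w).
unfold unit_disk in *. unfold pseudo_dist.
set (B := Cmod (1 - z * Cconj w)%C) in *.
assert (Hk := Cmod_ge_0 (z - w)%C). set (k := Cmod (z - w)%C) in *.
assert (P := Cmod_ge_0 z). assert (Q := Cmod_ge_0 w).
assert (HB0 : 0 < B) by lra.
split; [apply Rdiv_le_0_compat; lra|].
apply (Rmult_lt_reg_r B); [exact HB0|].
replace (k / B * B) with k by (field; lra).
assert (0 < (1 - Cmod z ^ 2) * (1 - Cmod w ^ 2)) by (apply Rmult_lt_0_compat; nra).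
nra.
Qed.

Lemma pseudo_dist_near_circle (w : C) (b : R) :
  unit_disk w -> 0 <= b < 1 ->
  exists r0, r0 < 1 /\ forall r z, r0 < r < 1 -> Cmod z = r -> b <= pseudo_dist z w.
Proof.
intros Hw [Hb Hb1]. unfold unit_disk in Hw.
assert (Q := Cmod_ge_0 w).
set (c := (1 - Cmod w) ^ 2).
assert (Hc : 0 < c) by (unfold c; nra).
assert (Hc1 : c <= 1) by (unfold c; nra).
set (e := (1 - b ^ 2) * c / 2).
assert (He : 0 < e <= 1 / 2).
{ assert (0 < 1 - b ^ 2 <= 1) by nra. unfold e; split; [apply Rdiv_lt_0_compat|]; nra. }
exists (1 - e). split; [lra|].
intros r z Hr Hz.
assert (Hz1 : unit_disk z) by (unfold unit_disk; lra).
destruct (disk_denominator_bound z w Hz1 Hw) as [HB _].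
assert (I := disk_automorphism_identity z w). rewrite Hz in I.
unfold pseudo_dist.
set (B := Cmod (1 - z * Cconj w)%C) in *.
assert (Hk := Cmod_ge_0 (z - w)%C). set (k := Cmod (z - w)%C) in *.
assert (HB0 : 0 < B) by lra.
apply (Rmult_le_reg_r B); [exact HB0|].
replace (k / B * B) with k by (field; lra).
assert (HcB : c <= B ^ 2) by (unfold c; nra).
assert (Hr2 : 1 - r ^ 2 <= (1 - b ^ 2) * c).
{ replace ((1 - b ^ 2) * c) with (2 * e) by (unfold e; field). clearbody e. nra. }
assert (H3 : (1 - r ^ 2) * (1 - Cmod w ^ 2) <= 1 - r ^ 2).
{ assert (0 <= (1 - r ^ 2) * Cmod w ^ 2) by (apply Rmult_le_pos; [nra|apply pow2_ge_0]). lra. }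
assert (H4 : (1 - b ^ 2) * c <= (1 - b ^ 2) * B ^ 2) by (apply Rmult_le_compat_l; nra).
assert (H5 : (b * B) ^ 2 <= k ^ 2) by (rewrite Rpow_mult_distr; lra).
assert (0 <= b * B) by nra. nra.
Qed.

(** The quotient of [phi] by the disk automorphism vanishing at [w] should be
    bounded by the maximum principle, but two derivatives of it at [w] would
    require a third one of [phi]. Its [n]-th power times [phi] tends to 0 at [w], hence is covered
    by the maximum principle as it stands; letting [n] tend to infinity removes
    the extra factor. *)
Lemma schwarz_pick_zero (phi : C -> C) (w : C) :
  hol2 unit_disk phi -> unit_disk w -> phi w = 0%C ->
  (forall z, unit_disk z -> Cmod (phi z) <= 1) ->
  forall z, unit_disk z -> Cmod (phi z) <= pseudo_dist z w.
Proof.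
intros Hphi Hw Hphiw Hphi1 z1 Hz1.
destruct (pseudo_dist_bounds z1 w Hz1 Hw) as [Hd0 Hd1].
destruct (Ceq_dec z1 w) as [->|Hz1w].
{ rewrite Hphiw, Cmod_0. exact Hd0. }
apply Rnot_lt_le. intros Hlt.
set (p := Cmod (phi z1)) in *. set (d := pseudo_dist z1 w) in *.
assert (Hp1 : p <= 1) by now apply Hphi1.
assert (Hd : 0 < d).
{ unfold d, pseudo_dist. destruct (disk_denominator_bound z1 w Hz1 Hw) as [HB _].
  unfold unit_disk in Hw. apply Rdiv_lt_0_compat; [|lra].
  apply Cmod_gt_0. intros E. apply Hz1w. replace z1 with (z1 - w + w)%C by ring.
  rewrite E. ring. }
(* if the claim fails at z1, its failure ratio tau leaves room for a circle on
   which the pseudo-distance to w is at least b > tau *)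
set (tau := d / p).
assert (Htau : 0 < tau < 1).
{ split; [apply Rdiv_lt_0_compat; lra|]. apply Rlt_div_l; lra. }
set (b := (1 + tau) / 2).
assert (Hb : tau < b < 1) by (unfold b; lra).
destruct (pseudo_dist_near_circle w b Hw) as (r0 & Hr0 & Hcirc); [lra|].
set (r1 := Rmax r0 (Cmod z1)). set (r := (1 + r1) / 2).
assert (Hr1 : r0 <= r1 /\ Cmod z1 <= r1 < 1).
{ unfold r1. split; [apply Rmax_l|]. split; [apply Rmax_r|]. now apply Rmax_lub_lt. }
assert (Hz10 := Cmod_ge_0 z1).
assert (Hr : r1 < r < 1) by (unfold r; lra).
(* at w, where the inverse is that of 0, the factor phi w = 0 decides the value *)
set (Q := fun z : C => (phi z * ((1 - z * Cconj w) * / (z - w)))%C).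
assert (HQ : forall z, unit_disk z -> z <> w -> Cmod (Q z) = Cmod (phi z) / pseudo_dist z w).
{ intros z Hz Hzw. unfold Q, pseudo_dist. rewrite !Cmod_mult.
  assert (Hzw0 : (z - w)%C <> 0%C).
  { intros E. apply Hzw. replace z with (z - w + w)%C by ring. rewrite E. ring. }
  rewrite Cmod_inv by exact Hzw0.
  destruct (disk_denominator_bound z w Hz Hw) as [HB _]. unfold unit_disk in Hw.
  assert (0 < Cmod (z - w)%C) by now apply Cmod_gt_0. field. split; lra. }
set (U := fun z : C => unit_disk z /\ z <> w).
assert (HQhol : hol2 U Q).
{ assert (Hphi' : hol2 U phi).
  { destruct Hphi as (f1 & f2 & F). exists f1, f2. intros z [Hz _]. now apply F. }
  apply hol2_mult; [exact Hphi'|]. apply hol2_mult.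
  - apply (hol2_plus U (fun _ => 1%C) (fun z => - (z * Cconj w))%C); [apply hol2_const|].
    destruct (hol2_mult U (fun z => z) (fun _ => (- Cconj w)%C) (hol2_id U) (hol2_const U _))
      as (f1 & f2 & F).
    exists f1, f2. intros z Hz. destruct (F z Hz) as [F1 F2]. split; [|exact F2].
    revert F1. apply is_cderive_ext_loc. exists 1. split; [lra|]. intros; ring.
  - apply hol2_inv.
    + intros z [_ Hzw] E. apply Hzw. replace z with (z - w + w)%C by ring. rewrite E. ring.
    + apply (hol2_plus U (fun z => z) (fun _ => (- w)%C)); [apply hol2_id|apply hol2_const]. }
assert (HUopen : forall z, U z -> exists rad, 0 < rad /\ forall x, Cmod (x - z)%C < rad -> U x).
{ intros z [Hz Hzw]. unfold unit_disk in Hz.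
  assert (Hzw0 : 0 < Cmod (w - z)%C).
  { apply Cmod_gt_0. intros E. apply Hzw. replace w with (w - z + z)%C by ring. rewrite E. ring. }
  exists (Rmin (1 - Cmod z) (Cmod (w - z)%C)). split; [apply Rmin_pos; lra|].
  intros x Hx. split.
  - assert (T := Cmod_dist x z). apply Rabs_le_between in T.
    assert (T2 := Rlt_le_trans _ _ _ Hx (Rmin_l _ _)). unfold unit_disk. lra.
  - intros ->. assert (T2 := Rlt_le_trans _ _ _ Hx (Rmin_r _ _)). lra. }
assert (Hn : forall n, p <= (tau / b) ^ n).
{ intros n.
  set (Psi := fun z => (phi z * Cpow (Q z) n)%C).
  assert (HPsi : hol2 U Psi).
  { apply hol2_mult; [|now apply hol2_pow].
    destruct Hphi as (f1 & f2 & F). exists f1, f2. intros z [Hz _]. now apply F. }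
  assert (Hm : 0 <= / b ^ n) by (left; apply Rinv_0_lt_compat, pow_lt; lra).
  assert (HP : Cmod (Psi z1) <= / b ^ n).
  { apply (disk_max_principle Psi r (/ b ^ n)); [lra|exact Hm| | | |lra].
    - intros z Hz. apply continuous_Cmod_iff. intros eps Heps.
      assert (Hzd : unit_disk z) by (unfold unit_disk; lra).
      destruct (Ceq_dec z w) as [->|Hzw].
      + destruct Hphi as (f1 & f2 & F). destruct (F w Hw) as [F1 _].
        destruct (is_cderive_continuous phi w _ F1 1 Rlt_0_1) as (d1 & Hd1' & A).
        set (L := Cmod (f1 w) + 1) in *.
        assert (HL : 0 < L) by (unfold L; assert (T := Cmod_ge_0 (f1 w)); lra).
        assert (HK : 0 < L * (2 * L) ^ n) by (apply Rmult_lt_0_compat; [lra|apply pow_lt; lra]).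
        set (K := L * (2 * L) ^ n) in *.
        exists (Rmin (Rmin d1 (eps / K)) (1 - Cmod w)).
        unfold unit_disk in Hw.
        split; [repeat apply Rmin_pos; try lra; now apply Rdiv_lt_0_compat|].
        intros x Hx.
        assert (Hx1 := Rlt_le_trans _ _ _ Hx (Rmin_l _ _)).
        assert (Hx2 := Rlt_le_trans _ _ _ Hx (Rmin_r _ _)).
        assert (Hx3 := Rlt_le_trans _ _ _ Hx1 (Rmin_l _ _)).
        assert (Hx4 := Rlt_le_trans _ _ _ Hx1 (Rmin_r _ _)).
        assert (HPw : Psi w = 0%C) by (unfold Psi; rewrite Hphiw; ring).
        rewrite HPw, Cmod_0, Rminus_0_r, Rabs_pos_eq by apply Cmod_ge_0.
        destruct (Ceq_dec x w) as [->|Hxw]; [rewrite HPw, Cmod_0; exact Heps|].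
        destruct (A x Hx3) as [A1 _]. rewrite Hphiw in A1.
        replace (phi x - 0)%C with (phi x) in A1 by ring.
        assert (Hxd : unit_disk x).
        { assert (T := Cmod_dist x w). apply Rabs_le_between in T. unfold unit_disk; lra. }
        destruct (disk_denominator_bound x w Hxd Hw) as [HB1 HB2].
        assert (Hk : 0 < Cmod (x - w)%C).
        { apply Cmod_gt_0. intros E. apply Hxw. replace x with (x - w + w)%C by ring. rewrite E. ring. }
        assert (HQx : Cmod (Q x) <= 2 * L).
        { rewrite HQ by assumption. unfold pseudo_dist.
          replace (Cmod (phi x) / (Cmod (x - w)%C / Cmod (1 - x * Cconj w)%C))
            with (Cmod (phi x) * Cmod (1 - x * Cconj w)%C / Cmod (x - w)%C) by (field; split; lra).
          apply Rle_div_l; [exact Hk|].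
          assert (T := Cmod_ge_0 (phi x)). nra. }
        unfold Psi. rewrite Cmod_mult, Cmod_pow.
        assert (HQn : Cmod (Q x) ^ n <= (2 * L) ^ n)
          by (apply pow_incr; split; [apply Cmod_ge_0|exact HQx]).
        apply Rle_lt_trans with (L * Cmod (x - w)%C * (2 * L) ^ n).
        * apply Rmult_le_compat; try assumption; [apply Cmod_ge_0|apply pow_le, Cmod_ge_0].
        * replace (L * Cmod (x - w)%C * (2 * L) ^ n) with (Cmod (x - w)%C * K) by (unfold K; ring).
          apply Rlt_div_r; assumption.
      + destruct HPsi as (f1 & f2 & F). destruct (F z) as [F1 _]; [now split|].
        destruct (is_cderive_continuous Psi z _ F1 eps Heps) as (d1 & Hd1' & A).
        exists d1; split; [exact Hd1'|]. intros x Hx. destruct (A x Hx) as [_ A2].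
        eapply Rle_lt_trans; [apply Cmod_dist|exact A2].
    - intros z Hz HPz.
      assert (HUz : U z).
      { split; [unfold unit_disk; lra|]. intros ->. apply HPz. unfold Psi. rewrite Hphiw. ring. }
      destruct (HUopen z HUz) as (rad & Hrad & HU). now exists U, rad.
    - intros z Hz.
      assert (Hzd : unit_disk z) by (unfold unit_disk; lra).
      assert (Hbz : b <= pseudo_dist z w) by (apply (Hcirc r); [lra|exact Hz]).
      assert (Hzw : z <> w).
      { intros ->. unfold pseudo_dist in Hbz. unfold Cminus in Hbz.
        rewrite Cplus_opp_r, Cmod_0 in Hbz. unfold Rdiv in Hbz. rewrite Rmult_0_l in Hbz. lra. }
      unfold Psi. rewrite Cmod_mult, Cmod_pow, HQ by assumption.
      assert (T := Cmod_ge_0 (phi z)). assert (T1 := Hphi1 z Hzd).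
      rewrite <- (Rmult_1_l (/ b ^ n)). apply Rmult_le_compat; try assumption.
      + apply pow_le, Rdiv_le_0_compat; lra.
      + rewrite <- pow_inv by lra. apply pow_incr. split; [apply Rdiv_le_0_compat; lra|].
        rewrite <- (Rmult_1_l (/ b)). apply Rmult_le_compat; try lra.
        * left; apply Rinv_0_lt_compat; lra.
        * apply Rinv_le_contravar; lra. }
  unfold Psi in HP. rewrite Cmod_mult, Cmod_pow, HQ in HP by assumption.
  fold p d in HP.
  assert (Ht : p / d = / tau) by (unfold tau; field; lra).
  rewrite Ht, pow_inv in HP.
  unfold Rdiv. rewrite Rpow_mult_distr, pow_inv.
  assert (Htn : 0 < tau ^ n) by (apply pow_lt; lra).
  apply (Rmult_le_compat_l (tau ^ n)) in HP; [|lra].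
  replace (tau ^ n * (p * / tau ^ n)) with p in HP by (field; lra). exact HP. }
destruct (pow_lt_1_zero (tau / b)) with (y := p) as [N HN].
- rewrite Rabs_pos_eq; [apply Rlt_div_l; lra|apply Rdiv_le_0_compat; lra].
- lra.
- specialize (HN N (Nat.le_refl N)). specialize (Hn N).
  rewrite Rabs_pos_eq in HN; [lra|]. apply pow_le, Rdiv_le_0_compat; lra.
Qed.

Lemma half_plane_denominator (a b : C) :
  0 < Re a -> 0 < Re b -> (a + Cconj b)%C <> 0%C.
Proof.
intros Ha Hb E. apply (f_equal Re) in E. destruct a, b; simpl in *. lra.
Qed.

(** The map [x -> (x - G w) / (x + conj (G w))] takes the right half-plane to
    the disk and [G w] to 0. *)
Lemma schwarz_pick_half_plane (G : C -> C) :
  hol2 unit_disk G -> (forall z, unit_disk z -> 0 < Re (G z)) ->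
  forall z w, unit_disk z -> unit_disk w ->
  Cmod (G z - G w)%C <= pseudo_dist z w * Cmod (G z + Cconj (G w))%C.
Proof.
intros HG Hre z w Hz Hw.
set (phi := fun x => ((G x - G w) * / (G x + Cconj (G w)))%C).
assert (Hden : forall x, unit_disk x -> (G x + Cconj (G w))%C <> 0%C)
  by (intros x Hx; apply half_plane_denominator; now apply Hre).
assert (Hmod : forall x, unit_disk x ->
  Cmod (phi x) = Cmod (G x - G w)%C / Cmod (G x + Cconj (G w))%C).
{ intros x Hx. unfold phi. now rewrite Cmod_mult, Cmod_inv by now apply Hden. }
assert (H : Cmod (phi z) <= pseudo_dist z w).
{ apply schwarz_pick_zero; try assumption.
  - apply hol2_mult.
    + apply (hol2_plus _ G (fun _ => (- G w)%C)); [exact HG|apply hol2_const].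
    + apply hol2_inv; [exact Hden|]. apply (hol2_plus _ G (fun _ => Cconj (G w))); [exact HG|apply hol2_const].
  - unfold phi. ring.
  - intros x Hx. rewrite Hmod by exact Hx.
    assert (P := Hre x Hx). assert (P' := Hre w Hw).
    assert (Q : 0 < Cmod (G x + Cconj (G w))%C) by now apply Cmod_gt_0, Hden.
    apply Rle_div_l; [exact Q|]. rewrite Rmult_1_l.
    assert (E : Cmod (G x - G w)%C ^ 2 <= Cmod (G x + Cconj (G w))%C ^ 2).
    { rewrite !Cmod_sqr. destruct (G x), (G w); simpl in *. nra. }
    assert (S := Cmod_ge_0 (G x - G w)%C). nra. }
rewrite Hmod in H by exact Hz.
generalize dependent (pseudo_dist z w); intros d H.
apply Rle_div_l in H; [exact H|]. now apply Cmod_gt_0, Hden.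
Qed.

(** Harnack's inequality for a positive harmonic function: in the half-plane
    inequality the imaginary parts contribute the same square to both moduli, and
    since the pseudo-distance is below 1 they can be dropped. *)
Lemma harnack (G : C -> C) :
  hol2 unit_disk G -> (forall z, unit_disk z -> 0 < Re (G z)) ->
  forall z w, unit_disk z -> unit_disk w ->
  Rabs (Re (G z) - Re (G w)) <= pseudo_dist z w * (Re (G z) + Re (G w)).
Proof.
intros HG Hre z w Hz Hw.
assert (H := schwarz_pick_half_plane G HG Hre z w Hz Hw).
destruct (pseudo_dist_bounds z w Hz Hw) as [D0 D1].
assert (P := Hre z Hz). assert (P' := Hre w Hw).
set (d := pseudo_dist z w) in *.
assert (H2 : Cmod (G z - G w)%C ^ 2 <= d ^ 2 * Cmod (G z + Cconj (G w))%C ^ 2).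
{ rewrite <- Rpow_mult_distr. apply pow_incr. split; [apply Cmod_ge_0|exact H]. }
rewrite !Cmod_sqr in H2. destruct (G z) as [a y], (G w) as [b x]; simpl in *.
assert (H3 : (a - b) ^ 2 <= (d * (a + b)) ^ 2).
{ assert (Hd2 : d ^ 2 <= 1) by nra.
  assert (0 <= (1 - d ^ 2) * (y - x) ^ 2) by (apply Rmult_le_pos; [lra|apply pow2_ge_0]).
  nra. }
assert (0 <= d * (a + b)) by nra.
apply Rabs_le_between. split; nra.
Qed.

(** The infinitesimal form of the half-plane inequality: divide by [|z - w|] and
    let [z] tend to [w]. *)
Lemma harnack_derivative (G : C -> C) (w l : C) :
  hol2 unit_disk G -> (forall z, unit_disk z -> 0 < Re (G z)) ->
  unit_disk w -> is_cderive G w l ->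
  Cmod l * (1 - Cmod w ^ 2) <= 2 * Re (G w).
Proof.
intros HG Hre Hw Hl.
assert (HB : Cmod (1 - w * Cconj w)%C = 1 - Cmod w ^ 2).
{ rewrite <- Cmod2_conj, <- RtoC_minus, Cmod_R. unfold unit_disk in Hw.
  apply Rabs_pos_eq. assert (T := Cmod_ge_0 w). nra. }
assert (HG2 : Cmod (G w + Cconj (G w))%C = 2 * Re (G w)).
{ replace (G w + Cconj (G w))%C with (RtoC (2 * Re (G w))).
  - rewrite Cmod_R. apply Rabs_pos_eq. assert (T := Hre w Hw). lra.
  - destruct (G w); unfold RtoC, Cplus, Cconj; simpl. f_equal; ring. }
rewrite <- HB, <- HG2.
assert (P := Cmod_ge_0 l). assert (PB := Cmod_ge_0 (1 - w * Cconj w)%C).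
assert (PG := Cmod_ge_0 (G w + Cconj (G w))%C).
set (B := Cmod (1 - w * Cconj w)%C) in *. set (S := Cmod (G w + Cconj (G w))%C) in *.
apply le_epsilon. intros eps Heps.
(* comparison at the point w + h gives (|l| - e) (B - e) <= S + e *)
set (e := Rmin 1 (eps / (2 + Cmod l + B))).
assert (He : 0 < e) by (apply Rmin_pos; [lra|apply Rdiv_lt_0_compat; lra]).
assert (He1 : e <= 1) by apply Rmin_l.
assert (He2 : e * (2 + Cmod l + B) <= eps).
{ apply Rle_div_r; [lra|apply Rmin_r]. }
clearbody e.
destruct (proj1 (is_cderive_iff _ _ _) Hl e He) as (d1 & Hd1 & A1).
destruct (is_cderive_continuous G w l Hl e He) as (d2 & Hd2 & A2).
unfold unit_disk in Hw. assert (Hw0 := Cmod_ge_0 w).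
set (h := Rmin (Rmin d1 d2) (Rmin (1 - Cmod w) e) / 2).
assert (Hm : 0 < Rmin (Rmin d1 d2) (Rmin (1 - Cmod w) e)) by (repeat apply Rmin_pos; lra).
assert (M1 := Rmin_l (Rmin d1 d2) (Rmin (1 - Cmod w) e)).
assert (M2 := Rmin_r (Rmin d1 d2) (Rmin (1 - Cmod w) e)).
assert (M3 := Rmin_l d1 d2). assert (M4 := Rmin_r d1 d2).
assert (M5 := Rmin_l (1 - Cmod w) e). assert (M6 := Rmin_r (1 - Cmod w) e).
assert (Hh : 0 < h /\ h < d1 /\ h < d2 /\ h < 1 - Cmod w /\ h < e) by (unfold h; lra).
destruct Hh as (Hh & K1 & K2 & K3 & K4).
set (z := (w + h)%C).
assert (Ez : Cmod (z - w)%C = h).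
{ unfold z. replace (w + h - w)%C with (RtoC h) by ring. rewrite Cmod_R. apply Rabs_pos_eq; lra. }
assert (Hz : unit_disk z).
{ assert (T := Cmod_dist z w). apply Rabs_le_between in T. unfold unit_disk; lra. }
assert (B1 := A1 z). assert (B2 := A2 z). rewrite Ez in B1, B2.
specialize (B1 K1). destruct (B2 K2) as [_ B3].
assert (H := schwarz_pick_half_plane G HG Hre z w Hz Hw).
destruct (disk_denominator_bound z w Hz Hw) as [HD _].
unfold pseudo_dist in H. rewrite Ez in H.
assert (C1 : h * Cmod l - e * h <= Cmod (G z - G w)%C).
{ assert (T := Cmod_triangle (G z - G w)%C (- (G z - G w - (z - w) * l))%C).
  replace (G z - G w + - (G z - G w - (z - w) * l))%C with ((z - w) * l)%C in T by ring.
  rewrite Cmod_opp, Cmod_mult, Ez in T. lra. }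
assert (C2 : Cmod (G z + Cconj (G w))%C <= S + e).
{ assert (T := Cmod_triangle (G w + Cconj (G w))%C (G z - G w)%C).
  replace (G w + Cconj (G w) + (G z - G w))%C with (G z + Cconj (G w))%C in T by ring.
  fold S in T. lra. }
assert (C3 : B - e <= Cmod (1 - z * Cconj w)%C).
{ assert (T := Cmod_dist (1 - w * Cconj w)%C (1 - z * Cconj w)%C).
  replace (1 - w * Cconj w - (1 - z * Cconj w))%C with ((z - w) * Cconj w)%C in T by ring.
  rewrite Cmod_mult, Cmod_conj, Ez in T. fold B in T. apply Rabs_le_between in T.
  assert (h * Cmod w <= e) by nra. lra. }
set (D := Cmod (1 - z * Cconj w)%C) in *. assert (HD0 : 0 < D) by lra.
set (X := Cmod (G z + Cconj (G w))%C) in *. assert (HX : 0 <= X) by apply Cmod_ge_0.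
assert (C4 : (Cmod l - e) * D <= X).
{ apply (Rmult_le_reg_l h); [exact Hh|].
  assert (Hq : h * X = h / D * X * D) by (field; lra). rewrite Hq.
  rewrite <- Rmult_assoc. apply Rmult_le_compat_r; lra. }
destruct (Rle_lt_dec (Cmod l) e) as [Hle|Hle].
- nra.
- assert ((Cmod l - e) * (B - e) <= S + e) by nra. nra.
Qed.

(** * Harmonic conjugates *)

Definition has_partials (p px py : C -> R) : Prop :=
  forall z, unit_disk z ->
    is_derive (fun x => p (x, Im z)) (Re z) (px z) /\
    is_derive (fun y => p (Re z, y)) (Im z) (py z).

Definition continuous_on_disk (p : C -> R) : Prop :=
  forall z, unit_disk z -> continuous p z.

Lemma disk_open z : unit_disk z -> locally z unit_disk.
Proof.
intros Hz. apply locally_Cmod. exists (1 - Cmod z). unfold unit_disk in *.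
split; [lra|]. intros w Hw. assert (T := Cmod_dist w z). apply Rabs_le_between in T. lra.
Qed.

Lemma continuous_slices (p : C -> R) (x y : R) :
  continuous p (x, y) ->
  continuous (fun s => p (s, y)) x /\ continuous (fun t => p (x, t)) y.
Proof.
intros H; split.
- apply (continuous_comp_2 (fun s : R => s) (fun _ : R => y) (fun s t => p (s, t)));
    [apply continuous_id|apply continuous_const|].
  apply continuous_ext with p; [now intros []|exact H].
- apply (continuous_comp_2 (fun _ : R => x) (fun t : R => t) (fun s t => p (s, t)));
    [apply continuous_const|apply continuous_id|].
  apply continuous_ext with p; [now intros []|exact H].
Qed.

Lemma continuous_continuity_2d (p : C -> R) (x y : R) :
  continuous p (x, y) -> continuity_2d_pt (fun s t => p (s, t)) x y.
Proof.
intros H. apply continuity_2d_pt_filterlim.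
eapply filterlim_ext; [|exact H]. now intros [a b].
Qed.

Lemma Cmod_vertical x y t : Rabs t <= Rabs y -> Cmod (x, t) <= Cmod (x, y).
Proof.
intros H. unfold Cmod; simpl fst; simpl snd. apply sqrt_le_1_alt.
apply Rplus_le_compat_l. rewrite <- (pow2_abs t), <- (pow2_abs y).
apply pow_incr. split; [apply Rabs_pos|exact H].
Qed.

Lemma between_abs (t y : R) : Rmin 0 y <= t <= Rmax 0 y -> Rabs t <= Rabs y.
Proof.
unfold Rmin, Rmax. destruct (Rle_dec 0 y); intros H.
- rewrite !Rabs_pos_eq; lra.
- rewrite !Rabs_left1; lra.
Qed.

Lemma locally_Rabs (P : R -> Prop) (y : R) :
  (exists d, 0 < d /\ forall y', Rabs (y' - y) < d -> P y') -> locally y P.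
Proof. intros (d & Hd & H). exists (mkposreal d Hd). intros w Hw. apply H, Hw. Qed.

Lemma disk_shift_fst x x' y : Rabs (x' - x) < 1 - Cmod (x, y) -> unit_disk (x', y).
Proof.
intros H. assert (T := Cmod_triangle (x, y) (RtoC (x' - x))). rewrite Cmod_R in T.
replace ((x, y) + RtoC (x' - x))%C with ((x', y) : C) in T.
- unfold unit_disk. lra.
- unfold RtoC, Cplus; simpl; f_equal; ring.
Qed.

Lemma disk_shift_snd x y y' : Rabs (y' - y) < 1 - Cmod (x, y) -> unit_disk (x, y').
Proof.
intros H. assert (T := Cmod_triangle (x, y) (0, (y' - y)%R)).
assert (T2 := Cmod_le_sum 0 (y' - y)). rewrite Rabs_R0 in T2.
replace ((x, y) + (0, (y' - y)%R))%C with ((x, y') : C) in T.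
- unfold unit_disk. lra.
- unfold RtoC, Cplus; simpl; f_equal; ring.
Qed.

(** The conjugate is the integral of [ux dy - uy dx] along the path that runs
    along the real axis and then vertically, which stays in the disk. Its
    vertical derivative is the fundamental theorem of calculus; its horizontal
    one is differentiation under the integral, where [uxx = - uyy] turns the
    integrand into a vertical derivative. *)
Lemma harmonic_conjugate (u ux uy uxx uxy uyy : C -> R) :
  has_partials u ux uy -> has_partials ux uxx uxy -> has_partials uy uxy uyy ->
  continuous_on_disk ux -> continuous_on_disk uy ->
  continuous_on_disk uxx -> continuous_on_disk uxy -> continuous_on_disk uyy ->
  (forall z, unit_disk z -> uxx z + uyy z = 0) ->
  exists v : C -> R, v (RtoC 0) = 0 /\
    hol2 unit_disk (fun z => (u z, v z)) /\
    forall z, unit_disk z -> is_cderive (fun z => (u z, v z)) z (ux z, - uy z).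
Proof.
intros Du Dux Duy Cux Cuy Cuxx Cuxy Cuyy Hlap.
set (v := fun z : C => RInt (fun t => ux (Re z, t)) 0 (Im z) - RInt (fun s => uy (s, 0)) 0 (Re z)).
assert (Hseg : forall x y t, unit_disk (x, y) -> Rmin 0 y <= t <= Rmax 0 y -> unit_disk (x, t)).
{ intros x y t H Ht. eapply Rle_lt_trans; [|exact H]. apply Cmod_vertical. now apply between_abs. }
assert (Hsx : forall x y s, unit_disk (x, y) -> Rmin 0 x <= s <= Rmax 0 x -> unit_disk (s, 0)).
{ intros x y s H Hs. unfold unit_disk in *.
  assert (T := Cmod_le_sum s 0). rewrite Rabs_R0 in T. apply between_abs in Hs.
  assert (T2 := re_le_Cmod (x, y)). simpl in T2. lra. }
assert (Iux : forall x y, unit_disk (x, y) -> ex_RInt (fun t => ux (x, t)) 0 y).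
{ intros x y H. apply (ex_RInt_continuous (V := R_CompleteNormedModule)). intros t Ht.
  apply (continuous_slices ux x t). apply Cux. now apply (Hseg x y). }
assert (Iuy : forall x y, unit_disk (x, y) -> ex_RInt (fun s => uy (s, 0)) 0 x).
{ intros x y H. apply (ex_RInt_continuous (V := R_CompleteNormedModule)). intros s Hs.
  apply (continuous_slices uy s 0). apply Cuy. now apply (Hsx x y). }
assert (Vy : forall z, unit_disk z -> is_derive (fun y => v (Re z, y)) (Im z) (ux z)).
{ intros [x y] Hz. unfold v; simpl. unfold unit_disk in Hz.
  eapply is_derive_eq.
  - apply (is_derive_minus (K := R_AbsRing) (V := R_NormedModule)).
    + apply (is_derive_RInt (V := R_NormedModule) (fun t => ux (x, t)) _ 0).
      * apply locally_Rabs. exists (1 - Cmod (x, y)). split; [lra|]. intros y' Hy'.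
        apply (RInt_correct (V := R_CompleteNormedModule)), Iux. exact (disk_shift_snd x y y' Hy').
      * apply (continuous_slices ux x y). now apply Cux.
    + apply (is_derive_const (K := R_AbsRing) (V := R_NormedModule)).
  - unfold minus, plus, opp, zero; simpl. ring. }
assert (Vx : forall z, unit_disk z -> is_derive (fun x => v (x, Im z)) (Re z) (- uy z)).
{ intros [x y] Hz. unfold v; simpl. unfold unit_disk in Hz.
  assert (Hloc : locally x (fun x' => unit_disk (x', y))).
  { apply locally_Rabs. exists (1 - Cmod (x, y)). split; [lra|]. intros x' Hx'.
    exact (disk_shift_fst x x' y Hx'). }
  eapply is_derive_eq.
  - apply (is_derive_minus (K := R_AbsRing) (V := R_NormedModule)).
    + apply (is_derive_RInt_param (fun x t => ux (x, t)) 0 y x).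
      * revert Hloc. apply filter_imp. intros x' Hx' t Ht.
        exists (uxx (x', t)). apply (Dux (x', t)). now apply (Hseg x' y).
      * intros t Ht. assert (Ht' : unit_disk (x, t)) by now apply (Hseg x y).
        apply continuity_2d_pt_ext_loc with (fun s t => uxx (s, t)).
        { apply locally_2d_locally. generalize (disk_open _ Ht'). apply filter_imp.
          intros [a b] Hab. simpl. symmetry. apply is_derive_unique.
          apply (Dux (a, b) Hab). }
        apply continuous_continuity_2d. now apply Cuxx.
      * revert Hloc. apply filter_imp. intros x' Hx'. now apply Iux.
    + apply (is_derive_RInt (V := R_NormedModule) (fun s => uy (s, 0)) _ 0).
      * revert Hloc. apply filter_imp. intros x' Hx'.
        apply (RInt_correct (V := R_CompleteNormedModule)). now apply (Iuy x' y).
      * apply (continuous_slices uy x 0). apply Cuy. apply (Hseg x y); [exact Hz|].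
        split; [apply Rmin_l|apply Rmax_l].
  - assert (E : is_RInt (fun t => Derive (fun x => ux (x, t)) x) 0 y (- (uy (x, y) - uy (x, 0)))).
    { apply (is_RInt_ext (fun t => - uyy (x, t))).
      - intros t Ht. assert (Ht' : unit_disk (x, t)) by (apply (Hseg x y); [exact Hz|lra]).
        specialize (Hlap _ Ht').
        symmetry. etransitivity; [apply is_derive_unique, (Dux (x, t) Ht')|].
        simpl. lra.
      - apply (is_RInt_opp (V := R_NormedModule)).
        apply (is_RInt_derive (V := R_CompleteNormedModule) (fun t => uy (x, t))).
        + intros t Ht. apply (Duy (x, t)). now apply (Hseg x y).
        + intros t Ht. apply (continuous_slices uyy x t). apply Cuyy. now apply (Hseg x y). }
    etransitivity; [apply (f_equal2 minus); [exact (is_RInt_unique _ _ _ _ E)|reflexivity]|].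
    unfold minus, plus, opp; simpl. ring. }
assert (D1 : forall z, unit_disk z -> is_cderive (fun z => (u z, v z)) z (ux z, - uy z)).
{ intros z Hz.
  apply (is_cderive_CR u v ux (fun z => - uy z) z).
  - generalize (disk_open z Hz). apply filter_imp. intros w Hw. now apply Du.
  - generalize (disk_open z Hz). apply filter_imp. intros w Hw. now apply Vx.
  - rewrite Ropp_involutive. now apply Du.
  - now apply Vy.
  - now apply Cux.
  - apply (continuous_opp (V := R_NormedModule) uy). now apply Cuy. }
exists v. split; [|split; [|exact D1]].
- unfold v; simpl. rewrite !RInt_point. unfold zero; simpl. ring.
- exists (fun z => (ux z, - uy z)), (fun z => (uxx z, - uxy z)).
  intros z Hz. split; [now apply D1|].
  apply (is_cderive_CR ux (fun z => - uy z) uxx (fun z => - uxy z) z).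
  + generalize (disk_open z Hz). apply filter_imp. intros w Hw. now apply Dux.
  + generalize (disk_open z Hz). apply filter_imp. intros w Hw.
    apply (is_derive_opp (K := R_AbsRing) (V := R_NormedModule) (fun x => uy (x, Im w))). now apply Duy.
  + rewrite Ropp_involutive. now apply Dux.
  + replace (uxx z) with (- uyy z) by (specialize (Hlap z Hz); lra).
    apply (is_derive_opp (K := R_AbsRing) (V := R_NormedModule) (fun y => uy (Re z, y))). now apply Duy.
  + now apply Cuxx.
  + apply (continuous_opp (V := R_NormedModule) uxy). now apply Cuxy.
Qed.

(** * The potential of an even decreasing density *)

(** [P] turns an [R]-harmonic function into a harmonic one with values in
    (-b, b). The last two fields are the one-sided forms of concavity on [0, 1):
    over [c, a] the chord is at least as steep as the tangent at [a], and the
    tangent at [u] reaches at least the height [b] above the end point 1. *)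
Record metric_potential (rho P : R -> R) (b : R) : Prop := {
  potential_derive : forall u, -1 < u < 1 -> is_derive P u (rho u);
  potential_0 : P 0 = 0;
  potential_opp : forall u, -1 < u < 1 -> P (- u) = - P u;
  potential_growth : forall c a, 0 <= c <= a -> a < 1 -> rho a * (a - c) <= P a - P c;
  potential_gap : forall u, 0 <= u < 1 -> 0 < b - P u <= rho u * (1 - u)
}.

(** [b] is the supremum of the values on [0, 1); it is finite because the
    density is at most its value at 0. Concavity is the mean value theorem. *)
Lemma metric_potential_exists (rho : R -> R)
  (rho_pos : forall u : R, -1 < u < 1 -> 0 < rho u)
  (rho_cont : forall u : R, -1 < u < 1 -> continuous rho u)
  (rho_even : forall u : R, -1 < u < 1 -> rho (- u) = rho u)
  (rho_decr : forall u v : R, 0 <= u -> u <= v -> v < 1 -> rho v <= rho u) :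
  exists (P : R -> R) (b : R), metric_potential rho P b.
Proof.
set (P := fun u => RInt rho 0 u).
assert (Hc0 : forall u t, -1 < u < 1 -> Rmin 0 u <= t <= Rmax 0 u -> continuous rho t).
{ intros u t Hu Ht. apply rho_cont.
  unfold Rmin, Rmax in Ht. destruct (Rle_dec 0 u); lra. }
assert (Hint : forall u, -1 < u < 1 -> is_RInt rho 0 u (P u)).
{ intros u Hu. apply (RInt_correct (V := R_CompleteNormedModule)).
  apply (ex_RInt_continuous (V := R_CompleteNormedModule)). intros t Ht. now apply (Hc0 u). }
assert (HP0 : P 0 = 0) by (unfold P; now rewrite RInt_point).
assert (HD : forall u, -1 < u < 1 -> is_derive P u (rho u)).
{ intros u Hu. apply (is_derive_RInt (V := R_NormedModule) rho P 0 u); [|now apply rho_cont].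
  apply locally_Rabs. exists (Rmin (u + 1) (1 - u)). split; [apply Rmin_pos; lra|].
  intros x Hx. apply Hint.
  assert (M1 := Rmin_l (u + 1) (1 - u)). assert (M2 := Rmin_r (u + 1) (1 - u)).
  apply Rabs_lt_between in Hx. lra. }
assert (Hodd : forall u, -1 < u < 1 -> P (- u) = - P u).
{ intros u Hu. apply (is_RInt_unique (V := R_CompleteNormedModule)).
  apply (is_RInt_ext (fun y => opp (opp (rho (- y))))).
  { intros x Hx. rewrite opp_opp. apply rho_even.
    unfold Rmin, Rmax in Hx. destruct (Rle_dec 0 (- u)); lra. }
  apply (is_RInt_opp (V := R_NormedModule)). apply (is_RInt_comp_opp (V := R_NormedModule)).
  rewrite Ropp_0, Ropp_involutive. now apply Hint. }
assert (Hmvt : forall c a, 0 <= c <= a -> a < 1 ->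
   rho a * (a - c) <= P a - P c <= rho c * (a - c)).
{ intros c a [Hc Hca] Ha. destruct (Rle_lt_or_eq_dec c a Hca) as [Hlt| <-]; [|lra].
  destruct (MVT_cor2 P rho c a Hlt) as (x & E & Hx).
  - intros x Hx. apply is_derive_Reals, HD. lra.
  - rewrite E. assert (R1 := rho_decr c x). assert (R2 := rho_decr x a).
    split; apply Rmult_le_compat_r; lra. }
destruct (completeness (fun y => exists u, 0 <= u < 1 /\ y = P u)) as [b [Hb1 Hb2]].
{ exists (rho 0). intros y (u & Hu & ->).
  assert (T := Hmvt 0 u). rewrite HP0 in T. assert (Hr := rho_pos 0). nra. }
{ exists 0, 0. rewrite HP0. lra. }
exists P, b. split; [exact HD|exact HP0|exact Hodd| |].
{ intros c a Hca Ha; now apply Hmvt. }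
intros u Hu. split.
- set (s := (1 + u) / 2). assert (Hs : u < s < 1) by (unfold s; lra).
  assert (P s <= b) by (apply Hb1; exists s; split; [lra|reflexivity]).
  assert (T := Hmvt u s). assert (Hr := rho_pos s). nra.
- assert (b <= P u + rho u * (1 - u)); [|lra]. apply Hb2. intros y (s & Hs & ->).
  assert (Hr : 0 < rho u) by (apply rho_pos; lra).
  destruct (Rle_lt_dec s u) as [Hsu|Hsu].
  + assert (T := Hmvt s u). nra.
  + assert (T := Hmvt u s). assert (rho u * (s - u) <= rho u * (1 - u)) by nra. lra.
Qed.

Lemma potential_above_chord rho P b u (HP : metric_potential rho P b) : 0 <= u < 1 -> u * b <= P u.
Proof.
assert (HP' := HP); destruct HP' as [_ P0 P_odd P_growth P_bound].
intros Hu. assert (A := P_bound u Hu). assert (B := P_growth 0 u). rewrite P0 in B. nra.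
Qed.

(** The slope [(b - P u) / (1 - u)] of the chord from [u] to the end point of the
    graph decreases with [u]. *)
Lemma potential_chord_slopes rho P b c a (HP : metric_potential rho P b) :
  0 <= c <= a -> a < 1 -> (1 - c) * (b - P a) <= (1 - a) * (b - P c).
Proof.
assert (HP' := HP); destruct HP' as [_ P0 P_odd P_growth P_bound].
intros Hca Ha. assert (A := P_bound a). assert (B := P_growth c a Hca Ha).
assert (A' : b - P a <= rho a * (1 - a)) by (apply A; lra).
assert (H1 : (a - c) * (b - P a) <= (a - c) * (rho a * (1 - a))) by (apply Rmult_le_compat_l; lra).
assert (H2 : (1 - a) * (rho a * (a - c)) <= (1 - a) * (P a - P c)) by (apply Rmult_le_compat_l; lra).
lra.
Qed.

Lemma potential_abs rho P b u (HP : metric_potential rho P b) : -1 < u < 1 -> Rabs (P u) = P (Rabs u).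
Proof.
assert (HP' := HP); destruct HP' as [_ P0 P_odd P_growth P_bound].
intros Hu. assert (Hb : 0 < b) by (assert (A := P_bound 0); rewrite P0 in A; lra).
destruct (Rle_lt_dec 0 u) as [H|H].
- assert (A := potential_above_chord rho P b u HP). rewrite !Rabs_pos_eq; nra.
- assert (A := potential_above_chord rho P b (- u) HP).
  rewrite (Rabs_left u) by lra. rewrite P_odd in * by lra. rewrite Rabs_left1; nra.
Qed.

Lemma potential_bounded rho P b u (HP : metric_potential rho P b) : -1 < u < 1 -> Rabs (P u) < b.
Proof.
assert (HP' := HP); destruct HP' as [_ P0 P_odd P_growth P_bound].
intros Hu. rewrite (potential_abs rho P b u HP Hu).
assert (A := P_bound (Rabs u)). assert (Rabs u < 1) by (apply Rabs_lt_between; lra).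
assert (T := Rabs_pos u). lra.
Qed.

(** With [K = exp (2 d)], [d] the hyperbolic distance of two points of the disk,
    the hypotheses are Harnack's inequality for [b - P f] and [b + P f].
    On one side of 0 a single one suffices: the slopes of chords to the end point
    give [(1 - c) / (1 - a) <= K], and [(1 + a) / (1 + c)] is at most this ratio.
    Across 0 both are multiplied, and [P] is compared with its chord on each
    side. *)
Lemma potential_cross_ratio rho P b c a K (HP : metric_potential rho P b) :
  -1 < c -> c <= a -> a < 1 -> 0 <= K ->
  b - P c <= K * (b - P a) -> b + P a <= K * (b + P c) ->
  (1 + a) * (1 - c) <= K ^ 2 * ((1 - a) * (1 + c)).
Proof.
assert (HP' := HP); destruct HP' as [_ P0 P_odd P_growth P_bound].
assert (Pos : forall c a K, 0 <= c <= a -> a < 1 -> 0 <= K -> b - P c <= K * (b - P a) ->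
  (1 + a) * (1 - c) <= K ^ 2 * ((1 - a) * (1 + c))).
{ clear c a K. intros c a K Hca Ha HK H.
  assert (A := potential_chord_slopes rho P b c a HP Hca Ha).
  assert (B : 0 < b - P a) by (apply P_bound; lra).
  assert (H1 : 1 - c <= K * (1 - a)).
  { apply (Rmult_le_reg_r (b - P a)); [exact B|]. nra. }
  assert (H2 : 1 + a <= K * (1 + c)).
  { apply (Rmult_le_reg_r (1 - a)); [lra|]. nra. }
  replace (K ^ 2 * ((1 - a) * (1 + c))) with ((K * (1 + c)) * (K * (1 - a))) by ring.
  apply Rmult_le_compat; lra. }
intros Hc Hca Ha HK H1 H2.
destruct (Rle_lt_dec 0 c) as [H|Hc0]; [apply Pos; lra|].
destruct (Rle_lt_dec a 0) as [H|Ha0].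
- assert (Q := Pos (- a) (- c) K). rewrite !P_odd in Q by lra.
  replace ((1 + a) * (1 - c)) with ((1 + - c) * (1 - - a)) by ring.
  replace ((1 - a) * (1 + c)) with ((1 - - c) * (1 + - a)) by ring.
  apply Q; lra.
- assert (A1 := potential_above_chord rho P b a HP). assert (A2 := potential_above_chord rho P b (- c) HP).
  assert (B1 : 0 < b - P a) by (apply P_bound; lra).
  assert (B2 : 0 < b - P (- c)) by (apply P_bound; lra).
  rewrite P_odd in A2, B2 by lra.
  assert (X1 : (1 + a) * (b - P a) <= (1 - a) * (b + P a)) by lra.
  assert (X2 : (1 - c) * (b + P c) <= (1 + c) * (b - P c)) by lra.
  assert (Y1 : (1 + a) * (b - P a) <= (1 - a) * (K * (b + P c)))
    by (eapply Rle_trans; [exact X1|apply Rmult_le_compat_l; lra]).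
  assert (Y2 : (1 - c) * (b + P c) <= (1 + c) * (K * (b - P a)))
    by (eapply Rle_trans; [exact X2|apply Rmult_le_compat_l; lra]).
  assert (Z : (1 + a) * (b - P a) * ((1 - c) * (b + P c))
              <= (1 - a) * (K * (b + P c)) * ((1 + c) * (K * (b - P a))))
    by (apply Rmult_le_compat; try lra; apply Rmult_le_pos; lra).
  apply (Rmult_le_reg_r ((b - P a) * (b + P c))); [apply Rmult_lt_0_compat; lra|].
  lra.
Qed.

Lemma artanh_le_double (q d : R) :
  0 <= d < 1 -> -1 < q < 1 ->
  (1 + q) * (1 - d) ^ 2 <= (1 + d) ^ 2 * (1 - q) -> artanh q <= 2 * artanh d.
Proof.
intros Hd Hq H. unfold artanh.
replace (2 * (/ 2 * ln ((1 + d) / (1 - d)))) with (/ 2 * (ln ((1 + d) / (1 - d)) + ln ((1 + d) / (1 - d)))) by field.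
assert (Hp : 0 < (1 + d) / (1 - d)) by (apply Rdiv_lt_0_compat; lra).
rewrite <- ln_mult by assumption.
apply Rmult_le_compat_l; [lra|]. apply ln_le; [apply Rdiv_lt_0_compat; lra|].
apply Rle_div_l; [lra|].
replace ((1 + d) / (1 - d) * ((1 + d) / (1 - d)) * (1 - q))
  with ((1 + d) ^ 2 * (1 - q) / (1 - d) ^ 2) by (field; lra).
apply Rle_div_r; [nra|exact H].
Qed.

(** The two moduli inequalities are those that Harnack's inequality yields for
    [b - P f] and [b + P f]. With [q] the pseudo-distance of [a] and [c],
    [(1 + q) / (1 - q)] is the cross ratio bounded by [((1 + d) / (1 - d))^2]. *)
Lemma potential_artanh_le rho P b c a d (HP : metric_potential rho P b) :
  -1 < c -> c <= a -> a < 1 -> 0 <= d < 1 ->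
  Rabs (P a - P c) <= d * (2 * b - P a - P c) ->
  Rabs (P a - P c) <= d * (2 * b + P a + P c) ->
  artanh ((a - c) / (1 - a * c)) <= 2 * artanh d.
Proof.
intros Hc Hca Ha Hd H1 H2.
assert (Hac : 0 < 1 - a * c) by nra.
assert (Q1 : 1 + (a - c) / (1 - a * c) = (1 + a) * (1 - c) / (1 - a * c)) by (field; lra).
assert (Q2 : 1 - (a - c) / (1 - a * c) = (1 - a) * (1 + c) / (1 - a * c)) by (field; lra).
assert (P1 : 0 < (1 + a) * (1 - c) / (1 - a * c))
  by (apply Rdiv_lt_0_compat; [apply Rmult_lt_0_compat|]; lra).
assert (P2 : 0 < (1 - a) * (1 + c) / (1 - a * c))
  by (apply Rdiv_lt_0_compat; [apply Rmult_lt_0_compat|]; lra).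
apply artanh_le_double; [exact Hd|lra|]. rewrite Q1, Q2.
apply Rabs_le_between in H1. apply Rabs_le_between in H2.
set (K := (1 + d) / (1 - d)).
assert (HK : K * (1 - d) = 1 + d) by (unfold K; field; lra).
assert (HK0 : 0 <= K) by (apply Rdiv_le_0_compat; lra).
assert (X := potential_cross_ratio rho P b c a K HP Hc Hca Ha HK0).
assert (Y : (1 + a) * (1 - c) <= K ^ 2 * ((1 - a) * (1 + c))).
{ apply X; apply (Rmult_le_reg_r (1 - d)); try lra.
  - replace (K * (b - P a) * (1 - d)) with (K * (1 - d) * (b - P a)) by ring. rewrite HK. lra.
  - replace (K * (b + P c) * (1 - d)) with (K * (1 - d) * (b + P c)) by ring. rewrite HK. lra. }
replace ((1 + d) ^ 2 * ((1 - a) * (1 + c) / (1 - a * c)))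
  with (K ^ 2 * ((1 - a) * (1 + c)) * ((1 - d) ^ 2 / (1 - a * c)))
  by (rewrite <- HK; field; lra).
replace ((1 + a) * (1 - c) / (1 - a * c) * (1 - d) ^ 2)
  with ((1 + a) * (1 - c) * ((1 - d) ^ 2 / (1 - a * c))) by (field; lra).
apply Rmult_le_compat_r; [|exact Y].
apply Rdiv_le_0_compat; [apply pow2_ge_0|lra].
Qed.

(** * Harmonicity of the potential along the mapping *)

Lemma Cmod_eq_of_sqr x y : 0 <= y -> Cmod x ^ 2 = y ^ 2 -> Cmod x = y.
Proof. intros Hy H. assert (Hx := Cmod_ge_0 x). nra. Qed.

Lemma has_partials_comp (h h' : R -> R) (p px py : C -> R) :
  (forall z, unit_disk z -> is_derive h (p z) (h' (p z))) ->
  has_partials p px py ->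
  has_partials (fun z => h (p z)) (fun z => h' (p z) * px z) (fun z => h' (p z) * py z).
Proof.
intros Hh Hp z Hz. destruct (Hp z Hz) as [A1 A2]. specialize (Hh z Hz).
rewrite (Rmult_comm _ (px z)), (Rmult_comm _ (py z)).
split.
- apply (is_derive_comp (K := R_AbsRing) (V := R_NormedModule) h (fun x => p (x, Im z))); [|exact A1].
  now destruct z.
- apply (is_derive_comp (K := R_AbsRing) (V := R_NormedModule) h (fun y => p (Re z, y))); [|exact A2].
  now destruct z.
Qed.

Lemma has_partials_mult (p px py q qx qy : C -> R) :
  has_partials p px py -> has_partials q qx qy ->
  has_partials (fun z => p z * q z) (fun z => px z * q z + p z * qx z)
    (fun z => py z * q z + p z * qy z).
Proof.
intros Hp Hq z Hz. destruct (Hp z Hz) as [A1 A2], (Hq z Hz) as [B1 B2]. destruct z as [x y].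
split.
- apply (is_derive_mult (K := R_AbsRing) (fun s => p (s, y)) (fun s => q (s, y)));
    [exact A1|exact B1|exact Rmult_comm].
- apply (is_derive_mult (K := R_AbsRing) (fun s => p (x, s)) (fun s => q (x, s)));
    [exact A2|exact B2|exact Rmult_comm].
Qed.

Lemma has_partials_ext (p px py qx qy : C -> R) :
  (forall z, unit_disk z -> px z = qx z /\ py z = qy z) ->
  has_partials p px py -> has_partials p qx qy.
Proof. intros E Hp z Hz. destruct (E z Hz) as [<- <-]. now apply Hp. Qed.

Lemma has_partials_dx_dy (p : C -> R) :
  (forall z, unit_disk z -> ex_dx p z /\ ex_dy p z) -> has_partials p (dx p) (dy p).
Proof. intros H z Hz. destruct (H z Hz). split; now apply Derive_correct. Qed.

(** One of the Cauchy-Riemann equations for the derivative of a holomorphic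
    completion is the equality of the mixed partials. *)
Lemma class_C2_mixed_partials (f : C -> R) :
  class_C 2 unit_disk f ->
  forall z, unit_disk z -> dy (dx f) z = dx (dy f) z.
Proof.
intros (_ & D1 & (Cx & Dx & (Cxx & _) & (Cxy & _)) & (Cy & Dy & (Cyx & _) & (Cyy & _))) [x y] Hz.
symmetry.
apply (Schwarz (fun u v => f (u, v)) x y).
- apply locally_2d_locally. generalize (disk_open _ Hz). apply filter_imp.
  intros [u v] Huv. simpl fst; simpl snd.
  destruct (D1 _ Huv), (Dx _ Huv), (Dy _ Huv). repeat split; assumption.
- apply (continuous_continuity_2d (dx (dy f))). now apply Cyx.
- apply (continuous_continuity_2d (dy (dx f))). now apply Cxy.
Qed.

Lemma continuous_on_disk_mult p q :
  continuous_on_disk p -> continuous_on_disk q -> continuous_on_disk (fun z => p z * q z).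
Proof.
intros Hp Hq z Hz. apply (continuous_mult (K := R_AbsRing)); [now apply Hp|now apply Hq].
Qed.

Lemma continuous_on_disk_plus p q :
  continuous_on_disk p -> continuous_on_disk q -> continuous_on_disk (fun z => p z + q z).
Proof.
intros Hp Hq z Hz. apply (continuous_plus (V := R_NormedModule)); [now apply Hp|now apply Hq].
Qed.

Lemma continuous_on_disk_comp (h : R -> R) p :
  (forall z, unit_disk z -> continuous h (p z)) ->
  continuous_on_disk p -> continuous_on_disk (fun z => h (p z)).
Proof. intros Hh Hp z Hz. apply (continuous_comp p h); [now apply Hp|now apply Hh]. Qed.

(** The Laplacian of [P f] is [rho f] times the left-hand side of the equation
    for [f], so [P f] is harmonic and is the real part of some [G], whose
    derivative has the modulus of the gradient of [P f]. *)
Lemma potential_holomorphic (rho P : R -> R) (f : C -> R)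
  (rho_pos : forall u : R, -1 < u < 1 -> 0 < rho u)
  (rho_smooth : smooth_on_interval rho)
  (f_harm : R_harmonic rho f)
  (HP : forall u, -1 < u < 1 -> is_derive P u (rho u)) :
  exists G : C -> C, hol2 unit_disk G /\ (forall z, Re (G z) = P (f z)) /\ Im (G 0%C) = 0 /\
    forall z, unit_disk z ->
      exists l, is_cderive G z l /\ Cmod l = rho (f z) * grad_norm f z.
Proof.
destruct f_harm as (Hf & HC & Heq).
assert (Hmix := class_C2_mixed_partials f HC).
destruct HC as (Cf & D1 & (Cx & Dx & (Cxx & _) & (Cxy & _)) & (Cy & Dy & (Cyx & _) & (Cyy & _))).
assert (Hrho : forall z, unit_disk z -> is_derive rho (f z) (Derive rho (f z))).
{ intros z Hz. apply Derive_correct. exact (rho_smooth 1%nat (f z) (Hf z Hz)). }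
assert (Crho : forall z, unit_disk z -> continuous rho (f z)).
{ intros z Hz. apply (ex_derive_continuous (V := R_NormedModule)). eexists. now apply Hrho. }
assert (Crho' : forall z, unit_disk z -> continuous (Derive rho) (f z)).
{ intros z Hz. apply (ex_derive_continuous (V := R_NormedModule)).
  exact (rho_smooth 2%nat (f z) (Hf z Hz)). }
assert (Crf := continuous_on_disk_comp rho f Crho Cf).
assert (Crf' := continuous_on_disk_comp (Derive rho) f Crho' Cf).
assert (Pf := has_partials_dx_dy f D1).
assert (Pfx := has_partials_dx_dy _ Dx). assert (Pfy := has_partials_dx_dy _ Dy).
assert (Pg := has_partials_comp P rho f _ _ (fun z Hz => HP (f z) (Hf z Hz)) Pf).
assert (Pr := has_partials_comp rho (Derive rho) f _ _ Hrho Pf).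
assert (Pgx := has_partials_mult _ _ _ _ _ _ Pr Pfx).
assert (Pgy := has_partials_mult _ _ _ _ _ _ Pr Pfy).
apply has_partials_ext with
  (qx := fun z => Derive rho (f z) * dy f z * dx f z + rho (f z) * dy (dx f) z)
  (qy := fun z => Derive rho (f z) * dy f z * dy f z + rho (f z) * dy (dy f) z) in Pgy.
2: { intros z Hz. rewrite (Hmix z Hz). split; ring. }
destruct (harmonic_conjugate _ _ _ _ _ _ Pg Pgx Pgy) as (v & Hv0 & Hhol & Hder);
  try (repeat lazymatch goal with
    | |- continuous_on_disk (fun z => _ + _) => apply continuous_on_disk_plus
    | |- continuous_on_disk (fun z => _ * _) => apply continuous_on_disk_mult
    end; assumption).
{ intros z Hz. assert (E := Heq z Hz). assert (Hr := rho_pos _ (Hf z Hz)).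
  unfold grad_norm in E. rewrite pow2_sqrt in E
    by (apply Rplus_le_le_0_compat; apply pow2_ge_0).
  unfold laplacian in E. apply (f_equal (Rmult (rho (f z)))) in E.
  rewrite Rmult_0_r in E. rewrite <- E. field. lra. }
exists (fun z => (P (f z), v z)). split; [exact Hhol|]. split; [reflexivity|].
split; [exact Hv0|].
intros z Hz. eexists. split; [now apply Hder|].
unfold grad_norm. assert (Hr := rho_pos _ (Hf z Hz)).
apply Cmod_eq_of_sqr; [apply Rmult_le_pos; [lra|apply sqrt_pos]|].
rewrite Cmod_sqr, Rpow_mult_distr, pow2_sqrt
    by (apply Rplus_le_le_0_compat; apply pow2_ge_0).
simpl. ring.
Qed.

(** * The harmonic Schwarz lemma *)

Lemma cos_double_atan r : cos (2 * atan r) = (1 - r ^ 2) / (1 + r ^ 2).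
Proof.
assert (H : 0 < 1 + r²) by (unfold Rsqr; nra).
rewrite cos_2a_cos, cos_atan.
replace (2 * (1 / sqrt (1 + r²)) * (1 / sqrt (1 + r²))) with (2 / (sqrt (1 + r²) * sqrt (1 + r²))).
- rewrite sqrt_sqrt by lra. unfold Rsqr in *. field. nra.
- field. apply Rgt_not_eq, sqrt_lt_R0, H.
Qed.

(** The strip [|Re| < b] is mapped to the right half-plane by
    [w -> exp (i PI w / (2 b))], where the Schwarz-Pick inequality at 0 reads
    [|E - 1| <= |z| |E + 1|]. For [E = e (cos t + i sin t)] this is weakest when
    [e = 1], and then it says [|tan (t / 2)| <= |z|]. *)
Lemma harmonic_schwarz (G : C -> C) (b : R) :
  0 < b -> hol2 unit_disk G -> (forall z, unit_disk z -> Rabs (Re (G z)) < b) ->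
  G 0%C = 0%C ->
  forall z, unit_disk z -> Rabs (Re (G z)) <= b * (4 / PI * atan (Cmod z)).
Proof.
intros Hb HG Hbound HG0 z Hz.
assert (HPI := PI_RGT_0).
set (k := PI / (2 * b)).
assert (Hk : 0 < k) by (apply Rdiv_lt_0_compat; lra).
set (E := fun z => cexp (RtoC k * Ci * G z)%C).
assert (HE : hol2 unit_disk E).
{ apply (hol2_comp unit_disk (fun _ => True) cexp); [easy|apply hol2_cexp|].
  apply (hol2_mult _ (fun _ => (RtoC k * Ci)%C)); [apply hol2_const|exact HG]. }
assert (HEz : forall w, E w = (exp (- (k * Im (G w))) * cos (k * Re (G w)),
                               exp (- (k * Im (G w))) * sin (k * Re (G w)))).
{ intros w. unfold E, cexp. destruct (G w) as [g v]; simpl.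
  replace ((k * 0 - 0 * 1) * g - (k * 1 + 0 * 0) * v) with (- (k * v)) by ring.
  replace ((k * 0 - 0 * 1) * v + (k * 1 + 0 * 0) * g) with (k * g) by ring. reflexivity. }
assert (Hth : forall w, unit_disk w -> Rabs (k * Re (G w)) < PI / 2).
{ intros w Hw. rewrite Rabs_mult, (Rabs_pos_eq k) by lra.
  replace (PI / 2) with (k * b) by (unfold k; field; lra).
  apply Rmult_lt_compat_l; [exact Hk|now apply Hbound]. }
assert (HEre : forall w, unit_disk w -> 0 < Re (E w)).
{ intros w Hw. rewrite HEz; simpl. apply Rmult_lt_0_compat; [apply exp_pos|].
  assert (T := Hth w Hw). apply Rabs_lt_between in T. apply cos_gt_0; lra. }
assert (H0 : unit_disk 0%C) by (unfold unit_disk; rewrite Cmod_0; lra).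
assert (H := schwarz_pick_half_plane E HE HEre z 0%C Hz H0).
assert (HE0 : E 0%C = 1%C).
{ rewrite HEz, HG0; simpl. rewrite Rmult_0_r, Ropp_0, exp_0, cos_0, sin_0.
  unfold RtoC; f_equal; ring. }
assert (Hd : pseudo_dist z 0%C = Cmod z).
{ unfold pseudo_dist.
  assert (E1 : (1 - z * Cconj 0)%C = 1%C) by (destruct z; unfold Cconj, RtoC, Cminus, Cplus, Copp, Cmult; simpl; f_equal; ring).
  assert (E2 : (z - 0)%C = z) by ring.
  rewrite E1, E2, Cmod_1. field. }
rewrite Hd, HE0, HEz in H. unfold unit_disk in Hz.
assert (Hr := Cmod_ge_0 z).
set (r := Cmod z) in *. specialize (Hth z Hz). set (t := k * Re (G z)) in *.
assert (He := exp_pos (- (k * Im (G z)))). set (e := exp (- (k * Im (G z)))) in *.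
assert (Hcos : (1 - r ^ 2) / (1 + r ^ 2) <= cos t).
{ apply Rle_div_l; [nra|].
  assert (H2 : Cmod (((e * cos t)%R, (e * sin t)%R) - 1)%C ^ 2
      <= r ^ 2 * Cmod (((e * cos t)%R, (e * sin t)%R) + Cconj 1)%C ^ 2).
  { rewrite <- Rpow_mult_distr. apply pow_incr. split; [apply Cmod_ge_0|exact H]. }
  rewrite !Cmod_sqr in H2. simpl in H2.
  assert (Hcs := sin2_cos2 t). unfold Rsqr in Hcs.
  assert (H3 : (e ^ 2 + 1) * (1 - r ^ 2) <= 2 * e * (cos t * (1 + r ^ 2))).
  { assert (Q : e ^ 2 = e ^ 2 * (sin t * sin t + cos t * cos t)) by (rewrite Hcs; ring).
    rewrite Q. lra. }
  assert (H4 : 2 * e * (1 - r ^ 2) <= (e ^ 2 + 1) * (1 - r ^ 2)).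
  { apply Rmult_le_compat_r; [nra|]. assert (T := pow2_ge_0 (e - 1)). lra. }
  apply (Rmult_le_reg_l (2 * e)); lra. }
rewrite <- cos_double_atan in Hcos.
assert (Hat : 0 <= atan r) by (rewrite <- atan_0; destruct Hr as [Hr| <-]; [left; now apply atan_increasing|lra]).
assert (Hat1 : atan r < PI / 4) by (rewrite <- atan_1; now apply atan_increasing).
assert (Ht : Rabs t <= 2 * atan r).
{ replace (cos t) with (cos (Rabs t)) in Hcos
    by (unfold Rabs; destruct (Rcase_abs t); [apply cos_neg|reflexivity]).
  apply cos_decr_0; try lra. apply Rabs_pos. }
unfold t in Ht. rewrite Rabs_mult, (Rabs_pos_eq k) in Ht by lra.
apply (Rmult_le_reg_l k); [exact Hk|].
replace (k * (b * (4 / PI * atan r))) with (2 * atan r) by (unfold k; field; lra).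
exact Ht.
Qed.

(** * The corollary *)

Theorem corollary1p6 (rho : R -> R) (f : C -> R)
  (rho_pos : forall u : R, -1 < u < 1 -> 0 < rho u)
  (rho_smooth : smooth_on_interval rho)
  (rho_even : forall u : R, -1 < u < 1 -> rho (- u) = rho u)
  (rho_decr : forall u v : R, 0 <= u -> u <= v -> v < 1 -> rho v <= rho u)
  (f_harm : R_harmonic rho f) :
  (forall z : C, unit_disk z ->
     grad_norm f z <= 2 * ((1 - (f z) ^ 2) / (1 - (Cmod z) ^ 2))) /\
  (forall z w : C, unit_disk z -> unit_disk w ->
     d_h (RtoC (f z)) (RtoC (f w)) <= 2 * d_h z w) /\
  (f (RtoC 0) = 0 ->
     forall z : C, unit_disk z -> Rabs (f z) <= 4 / PI * atan (Cmod z)).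
Proof.
assert (rho_cont : forall u, -1 < u < 1 -> continuous rho u).
{ intros u Hu. apply (ex_derive_continuous (V := R_NormedModule)). exact (rho_smooth 1%nat u Hu). }
destruct (metric_potential_exists rho rho_pos rho_cont rho_even rho_decr)
  as (P & b & HP).
destruct (potential_holomorphic rho P f rho_pos rho_smooth f_harm (potential_derive _ _ _ HP))
  as (G & HG & HRe & HIm0 & HGD).
assert (Hf : forall z, unit_disk z -> -1 < f z < 1) by apply f_harm.
assert (Habs := fun u => potential_abs rho P b u HP).
assert (Hbd : forall z, unit_disk z -> Rabs (P (f z)) < b)
  by (intros z Hz; apply (potential_bounded rho P b _ HP); now apply Hf).
(* s = 1 and s = -1 give the positive harmonic functions b + P f and b - P f *)
assert (Hside : forall s, s = 1 \/ s = -1 ->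
  hol2 unit_disk (fun z => RtoC b + RtoC s * G z)%C /\
  (forall z, Re (RtoC b + RtoC s * G z)%C = b + s * P (f z)) /\
  (forall z, unit_disk z -> 0 < Re (RtoC b + RtoC s * G z)%C)).
{ intros s Hs.
  assert (ERe : forall z, Re (RtoC b + RtoC s * G z)%C = b + s * P (f z)).
  { intros z. rewrite <- HRe. destruct (G z); simpl; ring. }
  split; [|split; [exact ERe|]].
  - apply (hol2_plus _ (fun _ => RtoC b)); [apply hol2_const|].
    apply (hol2_mult _ (fun _ => RtoC s)); [apply hol2_const|exact HG].
  - intros z Hz. rewrite ERe. assert (T := Hbd z Hz). apply Rabs_lt_between in T.
    destruct Hs as [-> | ->]; lra. }
split; [|split].
- intros z Hz.
  destruct (HGD z Hz) as (l & Hl & El).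
  assert (Hgr : forall s, s = 1 \/ s = -1 -> Rabs s = 1 ->
    rho (f z) * grad_norm f z * (1 - Cmod z ^ 2) <= 2 * (b + s * P (f z))).
  { intros s Hs Hs1. destruct (Hside s Hs) as (H1 & H2 & H3).
    assert (T := harnack_derivative (fun z => RtoC b + RtoC s * G z)%C z (RtoC s * l)%C H1 H3 Hz).
    cbv beta in T. rewrite H2, Cmod_mult, Cmod_R, Hs1, Rmult_1_l, El in T. apply T.
    replace (RtoC s * l)%C with (0 + (0 * G z + RtoC s * l))%C by ring.
    apply (is_cderive_plus (fun _ => RtoC b)); [apply is_cderive_const|].
    apply (is_cderive_mult (fun _ => RtoC s)); [apply is_cderive_const|exact Hl]. }
  assert (Hm := Hgr (-1) (or_intror eq_refl)). assert (Hp := Hgr 1 (or_introl eq_refl)).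
  rewrite (Rabs_left1 (-1)) in Hm by lra. rewrite (Rabs_pos_eq 1) in Hp by lra.
  assert (HA : rho (f z) * grad_norm f z * (1 - Cmod z ^ 2) <= 2 * (b - Rabs (P (f z)))).
  { unfold Rabs. destruct (Rcase_abs (P (f z))); lra. }
  assert (Hfz := Hf z Hz). assert (Hrz := rho_pos _ Hfz).
  assert (Ha := Rabs_pos (f z)).
  assert (Ha1 : Rabs (f z) < 1) by (apply Rabs_lt_between; lra).
  rewrite (Habs _ Hfz) in HA. destruct (potential_gap _ _ _ HP (Rabs (f z))) as [_ HB]; [lra|].
  assert (Hre : rho (Rabs (f z)) = rho (f z)).
  { unfold Rabs; destruct (Rcase_abs (f z)); [now apply rho_even|reflexivity]. }
  rewrite Hre in HB.
  unfold unit_disk in Hz. assert (Hz0 := Cmod_ge_0 z).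
  assert (HD : 0 < 1 - Cmod z ^ 2) by nra.
  replace (2 * ((1 - f z ^ 2) / (1 - Cmod z ^ 2))) with (2 * (1 - f z ^ 2) / (1 - Cmod z ^ 2)) by (field; lra).
  apply Rle_div_r; [exact HD|].
  apply (Rmult_le_reg_l (rho (f z))); [exact Hrz|].
  rewrite <- (pow2_abs (f z)).
  assert (rho (f z) * (1 - Rabs (f z)) <= rho (f z) * (1 - Rabs (f z) ^ 2))
    by (apply Rmult_le_compat_l; [lra|nra]).
  lra.
- intros z w Hz Hw.
  change (d_h z w) with (artanh (pseudo_dist z w)).
  assert (Hd := pseudo_dist_bounds z w Hz Hw).
  destruct (Hside (-1) (or_intror eq_refl)) as (M1 & M2 & M3).
  destruct (Hside 1 (or_introl eq_refl)) as (N1 & N2 & N3).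
  assert (HM := harnack _ M1 M3 z w Hz Hw). cbv beta in HM. rewrite !M2 in HM.
  assert (HN := harnack _ N1 N3 z w Hz Hw). cbv beta in HN. rewrite !N2 in HN.
  set (d := pseudo_dist z w) in *. clearbody d.
  replace (b + -1 * P (f z) - (b + -1 * P (f w))) with (- (P (f z) - P (f w))) in HM by ring.
  rewrite Rabs_Ropp in HM.
  replace (b + 1 * P (f z) - (b + 1 * P (f w))) with (P (f z) - P (f w)) in HN by ring.
  replace (b + -1 * P (f z) + (b + -1 * P (f w))) with (2 * b - P (f z) - P (f w)) in HM by ring.
  replace (b + 1 * P (f z) + (b + 1 * P (f w))) with (2 * b + P (f z) + P (f w)) in HN by ring.
  assert (Hdh : d_h (RtoC (f z)) (RtoC (f w)) = artanh (Rabs (f z - f w) / (1 - f z * f w))).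
  { unfold d_h. replace (Cconj (RtoC (f w))) with (RtoC (f w))
      by (unfold RtoC, Cconj; simpl; f_equal; ring).
    rewrite <- RtoC_mult, <- !RtoC_minus, !Cmod_R. f_equal. f_equal.
    destruct (Hf z Hz), (Hf w Hw). apply Rabs_pos_eq. nra. }
  destruct (Hf z Hz), (Hf w Hw).
  rewrite Hdh. destruct (Rle_lt_dec (f w) (f z)) as [Hle|Hle].
  + rewrite Rabs_pos_eq by lra. now apply (potential_artanh_le rho P b).
  + rewrite Rabs_minus_sym, Rabs_pos_eq by lra. rewrite (Rmult_comm (f z)).
    apply (potential_artanh_le rho P b); try assumption; try lra; rewrite Rabs_minus_sym; lra.
- intros Hf0 z Hz.
  assert (Hb : 0 < b) by (assert (T := Hbd z Hz); assert (T2 := Rabs_pos (P (f z))); lra).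
  assert (HG0 : G 0%C = 0%C).
  { assert (T := HRe 0%C). rewrite Hf0, (potential_0 _ _ _ HP) in T. destruct (G 0%C); simpl in *. now subst. }
  assert (H := harmonic_schwarz G b Hb HG).
  assert (HB : Rabs (P (f z)) <= b * (4 / PI * atan (Cmod z))).
  { rewrite <- HRe. apply H; try assumption. intros w Hw. rewrite HRe. now apply Hbd. }
  assert (Hfz := Hf z Hz). rewrite Habs in HB by exact Hfz.
  assert (T := potential_above_chord rho P b (Rabs (f z)) HP).
  assert (Ha := Rabs_pos (f z)).
  assert (Ha1 : Rabs (f z) < 1) by (apply Rabs_lt_between; lra).
  apply (Rmult_le_reg_l b); [exact Hb|]. lra.
Qed.
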